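(* Let $\varepsilon\in(0,1)$. Let $\{X_t\}_{t\ge0}$ be the labelled exclusion process on the complete graph on $n$ vertices with $n$ balls in total, $\ell=\ell(n)$ labelled balls, where $1\le\ell\le(1-\varepsilon)n/2$, and intensity $\alpha=2/n^2$, started from a fixed state, and let $\pi$ be the uniform distribution on its state space. Then for $t=\frac14n\log(\ell(n-1))+cn$, where $c$ is a constant (with $t\ge0$), $$e^{-2c}\le\|\mathbb{P}(X_t\in\cdot)-\pi\|_2\le2e^{-2c},$$ where the upper bound applies for $c\ge0$ and sufficiently large $n$ (i.e. there is $n_0=n_0(\varepsilon)$ such that it holds for all $n\ge n_0$, all integers $1\le\ell\le(1-\varepsilon)n/2$ and all $c\ge0$). In particular, for every $\delta\in(0,1)$ there is a constant $C(\delta)$, depending only on $\delta$ (and on the fixed $\varepsilon$), such that for all such $n$ and $\ell$, $$\left|\tau_2(\delta)-\tfrac14n\log(\ell n)\right|\le C(\delta)\,n .$$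
   Context: Let $V$ be the vertex set of the complete graph on $n$ vertices. $(V)_\ell$ denotes the set of ordered $\ell$-tuples $x=(v_1,\ldots,v_\ell)$ of distinct elements of $V$ ($v_j$ is the position of ball $j$). The labelled exclusion process (LEP) with parameters $\ell$ ($1\le\ell\le n$) and $\alpha>0$ is the continuous time Markov process on $(V)_\ell$ with generator $[q_{x,x'}]_{x,x'\in(V)_\ell}$ given by $q_{x,x}=-\alpha\left(\ell(n-\ell)+\binom\ell2\right)$; $q_{x,x'}=\alpha$ whenever $x$ and $x'$ differ in exactly one coordinate or $x'$ can be obtained from $x$ by interchanging two of its coordinates; and $q_{x,x'}=0$ otherwise. Its stationary distribution $\pi$ is uniform on $(V)_\ell$. For a probability measure $\mu$ on a finite set $S$ and $\pi$ a probability measure on $S$ with full support, $\|\mu-\pi\|_2^2=\sum_{s\in S}\frac{(\mu(s)-\pi(s))^2}{\pi(s)}$, which equals $|S|\sum_{s\in S}(\mu(s)-\pi(s))^2$ when $\pi$ is uniform. $\mathbb{P}_{x_0}$ denotes the law of the process started from $X_0=x_0$; by symmetry $\|\mathbb{P}_{x_0}(X_t\in\cdot)-\pi\|_2$ does not depend on $x_0$, so $x_0$ is dropped from the notation. The $L^2$-mixing time is $\tau_2(\delta)=\inf\{t\ge 0:\max_{x_0}\|\mathbb{P}_{x_0}(X_t\in\cdot)-\pi\|_2\le2\delta\}$. *)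

(* Defs.v *)
From HB Require Import structures.
From mathcomp Require Import all_boot all_order all_algebra all_fingroup.
From mathcomp Require Import all_classical all_reals all_analysis.

Set Implicit Arguments.
Unset Strict Implicit.
Unset Printing Implicit Defensive.

Import Order.TTheory GRing.Theory Num.Theory.
Import numFieldNormedType.Exports.

Local Open Scope classical_set_scope.
Local Open Scope ring_scope.

Section MatrixExponential.
Variable R : realType.

(* The exponential series, summed entrywise. *)
Definition expmx (m : nat) (A : 'M[R]_m) : 'M[R]_m :=
  \matrix_(i, j) limn (series (fun k => (A ^+ k) i j / k`!%:R)).

(* Matrices are indexed by ordinals, so a kernel on a finite type S is
   transported along the enumeration of S. *)
Definition kernel_mx (S : finType) (Q : S -> S -> R) : 'M[R]_#|S| :=
  \matrix_(i, j) Q (enum_val i) (enum_val j).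

(* p_t = exp (t Q), the transition function generated by Q. *)
Definition transition (S : finType) (Q : S -> S -> R) (t : R) (x y : S) : R :=
  expmx (t *: kernel_mx Q) (enum_rank x) (enum_rank y).

End MatrixExponential.

(* Continuous-time Markov process on the finite set S with generator Q, started
   from x0. The Markov property is given in its finite-dimensional form
     P(X_{s_0} = x_0, ..., X_{s_{k+1}} = x_{k+1})
       = P(X_{s_0} = x_0, ..., X_{s_k} = x_k) p_{s_{k+1} - s_k}(x_k, x_{k+1}),
   for all k >= 0 and 0 <= s_0 <= ... <= s_{k+1}. Only times t >= 0 matter, and
   no regularity of the sample paths is required. *)
Record markov_process (R : realType) (S : finType) (Q : S -> S -> R)
    (d : measure_display) (Omega : measurableType d) (P : probability Omega R)
    (X : R -> Omega -> S) (x0 : S) : Prop := MarkovProcess {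
  markov_process_measurable : forall (t : R) (x : S),
    0 <= t -> measurable (X t @^-1` [set x]) ;
  markov_process_start : P (X 0 @^-1` [set x0]) = 1%E ;
  markov_process_markov : forall (k : nat) (s : nat -> R) (x : nat -> S),
    0 <= s 0%N -> (forall i, (i <= k)%N -> s i <= s i.+1) ->
    P (\bigcap_(i < k.+2) X (s i) @^-1` [set x i]) =
    (P (\bigcap_(i < k.+1) X (s i) @^-1` [set x i]) *
      (transition Q (s k.+1 - s k) (x k) (x k.+1))%:E)%E
}.

Definition law (R : realType) (S : finType)
    (d : measure_display) (Omega : measurableType d) (P : probability Omega R)
    (Y : Omega -> S) : S -> R :=
  fun y => fine (P (Y @^-1` [set y])).

Definition uniform (R : realType) (S : finType) : S -> R :=
  fun=> #|S|%:R^-1.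
Arguments uniform R {S}.

Definition l2dist (R : realType) (S : finType) (mu pi : S -> R) : R :=
  Num.sqrt (\sum_(s : S) (mu s - pi s) ^+ 2 / pi s).

(* The L^2-mixing time of a Markov process X under the family (P x0) of laws
   indexed by the initial state; an extended real, +oo if the level is never
   reached. *)
Definition mixing_time2 (R : realType) (S : finType) (pi : S -> R)
    (d : measure_display) (Omega : measurableType d)
    (P : S -> probability Omega R) (X : R -> Omega -> S) (delta : R) : \bar R :=
  ereal_inf [set t%:E | t in [set t : R | 0 <= t /\
    \big[Num.max/0]_(x0 : S) l2dist (law (P x0) (X t)) pi <= 2 * delta]].

(* (V)_l for V = 'I_n: the positions of l labelled balls. *)
Notation lep_state n l := {x : l.-tuple 'I_n | uniq x}.

Section LEP.
Variables (R : realType) (n l : nat).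

Definition differ_in_one (x x' : lep_state n l) : bool :=
  #|[set j : 'I_l | tnth (val x) j != tnth (val x') j]%SET| == 1%N.

Definition interchanged (x x' : lep_state n l) : bool :=
  [exists i : 'I_l, exists j : 'I_l, (i != j) &&
    [forall k : 'I_l, tnth (val x') k == tnth (val x) (tperm i j k)]].

Definition lep_generator (alpha : R) (x x' : lep_state n l) : R :=
  if x == x' then - (alpha * (l * (n - l) + 'C(l, 2))%:R)
  else if differ_in_one x x' || interchanged x x' then alpha
  else 0.

End LEP.

(* Main.v *)
Require Import Defs.
From HB Require Import structures.
From mathcomp Require Import all_boot all_order all_algebra all_fingroup.
From mathcomp Require Import complex spectral ring lra zify.
From mathcomp Require Import all_classical all_reals all_analysis.
Set Implicit Arguments.
Unset Strict Implicit.
Unset Printing Implicit Defensive.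
Import Order.TTheory GRing.Theory Num.Theory.
Import numFieldNormedType.Exports.

Local Open Scope classical_set_scope.
Local Open Scope ring_scope.

(** The matrix [Q] of the labelled exclusion process is symmetric, hence has a
    real eigenbasis with eigenvalues [d_a], and its entries are invariant under
    the relabellings of the vertices, which act transitively on the states.  So
    the diagonal of [exp (2 t Q)] is constant, and with [N] states
    [[
      ||P_t - pi||_2^2 = N p_{2t}(x0, x0) - 1 = tr (exp (2 t Q)) - 1
                       = sum_a exp (2 t d_a) - 1
    ]]
    ([l2dist_transition]).  Both bounds are estimates of this trace.

    Lower bound ([trace_lower]).  The centred indicators of the events that ball
    [j] is at vertex [w] are eigenvectors for [- alpha n]; they span a space of
    dimension [l (n - 1)], and the constants are an eigenvector for [0].  Hence
    the trace is at least [1 + l (n - 1) exp (- 2 t alpha n)], which for the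
    given [t] is [1 + exp (- 4 c)].

    Upper bound ([trace_upper]).  Filter the functions on the state space by the
    number [k] of balls on which they depend: let [H_k] be spanned by the
    indicators that prescribe the positions of [k] given balls, so that
    [dim H_k <= C(l,k) n^k].  The generator preserves [H_k], and modulo [H_{k-1}]
    it acts as [- alpha k (n - k + 1)] plus the generator of the chain that
    interchanges the [k] balls.  The latter satisfies a maximum principle, so
    an eigenvector in [H_k] but not in [H_{k-1}] has an eigenvalue at most
    [- alpha k (n - k + 1)] ([top_level_sum], [eigenvalue_level]).  Thus
    [[
      sum_a exp (s d_a) <= sum_k C(l,k) n^k exp (- s alpha k (n - k + 1)).
    ]]
    In terms of the symmetric group, level [k] collects the irreducible components
    whose diagrams have [k] boxes below the first row, and all of them are
    estimated by the same rate.

    It remains to estimate this sum at [c = 0].  With [L = l (n - 1)] its [k]-th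
    term is about [L^(k (k - 1) / n) / k!].  As long as [k] is at most of the
    order [n / log n], the numerator is bounded by a constant close to one to the
    power [k], and the terms add up to less than [3]; for larger [k], the factor
    [k!] wins because [2 (k - 1) <= (1 - eps) n] ([sum_weight_le4]).  The
    statement on the mixing time follows by solving the two bounds for [t]; for
    the finitely many small [n], a crude bound of the sum suffices. *)

(** * Exponentials of symmetric matrices *)

(** The spectral theorem over the complex numbers gives real eigenvalues; two
    real matrices that are similar over the complex numbers are similar over the
    reals. *)
Lemma symmetric_diagonalizable (R : realType) N (A : 'M[R]_N) : A^T = A ->
  exists P : 'M[R]_N, exists d : 'rV[R]_N,
    P \in unitmx /\ A = invmx P *m diag_mx d *m P.
Proof.
move=> Asym.
pose rc : {rmorphism R -> R[i]%C} := real_complex R.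
pose B := map_mx rc A.
have rcR x : rc x \is Num.real by apply/complex_realP; exists x.
have Breal : B \is a mxOver Num.real by apply/mxOverP=> i j; rewrite mxE.
have Bherm : B \is hermsymmx.
  apply: realsym_hermsym => //; apply/is_hermitianmxP.
  by rewrite expr0 scale1r; apply/matrixP => i j; rewrite !mxE -[in LHS]Asym mxE.
have Dreal := hermitian_spectral_diag_real Bherm.
have /hermitian_normalmx/orthomx_spectralP := Bherm.
set P := spectralmx B; set D := spectral_diag B => BE.
have Punit : P \in unitmx by apply: spectral_unit.
have [||P' /andP[P'real P'unit]] := @real_similar _ _ B (diag_mx D) _ Breal.
- exists P => //; apply/similarP => //.
  by rewrite BE -!mulmxA mulKVmx.
- apply/mxOverP => i j; rewrite mxE; case: eqP => _; rewrite ?mulr0n ?real0//.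
  by rewrite mulr1n (mxOverP Dreal).
move/(similarP P'unit) => E.
have mapK m n (M : 'M[R[i]%C]_(m, n)) : M \is a mxOver Num.real ->
    map_mx rc (map_mx (@complex.Re R) M) = M.
  by move=> /mxOverP Mr; apply/matrixP => i j; rewrite !mxE; apply: RRe_real.
pose PR := map_mx (@complex.Re R) P'.
have PRunit : PR \in unitmx by rewrite -(map_unitmx rc) mapK.
exists PR, (map_mx (@complex.Re R) D); split=> //.
apply: (can_inj (mulKmx PRunit)); rewrite -!mulmxA mulKVmx //.
apply: (@map_mx_inj _ _ rc).
by rewrite !map_mxM /= map_diag_mx !mapK.
Qed.

Lemma exprmxZ (R : comPzRingType) N (t : R) (A : 'M[R]_N) k :
  (t *: A) ^+ k = t ^+ k *: A ^+ k.
Proof.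
elim: k => [|k IH]; first by rewrite !expr0 scale1r.
by rewrite !exprS IH -!mulmxE -scalemxAr -scalemxAl scalerA mulrC.
Qed.

Section Exponential.
Variables (R : realType) (N : nat) (P : 'M[R]_N) (d : 'rV[R]_N).
Hypothesis Punit : P \in unitmx.
Let A := invmx P *m diag_mx d *m P.

Lemma exp_diag_sum (t : R) (c : 'I_N -> R) :
  series (fun k => \sum_a c a * exp_coeff (t * d 0 a) k) @ \oo
     --> \sum_a c a * expR (t * d 0 a).
Proof.
rewrite (_ : series _ =
    fun n => \sum_a (c a * series (exp_coeff (t * d 0 a)) n)); last first.
  apply/funext => n; rewrite /series /= exchange_big /=.
  by apply: eq_bigr => a _; rewrite mulr_sumr.
apply: (cvg_big (op := +%R)); first exact: add_continuous.
by move=> a _; apply: cvgMr; exact: is_cvg_series_exp_coeff.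
Qed.

Lemma diag_power k : A ^+ k = invmx P *m diag_mx (\row_a d 0 a ^+ k) *m P.
Proof.
elim: k => [|k IH].
  rewrite expr0 (_ : diag_mx _ = 1%:M) ?mulmx1 ?mulVmx//.
  by apply/matrixP=> i j; rewrite !mxE expr0.
rewrite exprS IH /A -mulmxE !mulmxA mulmxK // -(mulmxA (invmx P)) mulmx_diag.
congr (_ *m diag_mx _ *m _); apply/rowP => a; rewrite !mxE exprS //.
Qed.

Lemma expmx_diag t :
  expmx (t *: A) = invmx P *m diag_mx (\row_a expR (t * d 0 a)) *m P.
Proof.
apply/matrixP => i j; rewrite mxE; apply/cvg_lim => //.
have -> : (invmx P *m diag_mx (\row_a expR (t * d 0 a)) *m P) i j =
   \sum_a (invmx P i a * P a j) * expR (t * d 0 a).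
  by rewrite mxE; apply: eq_bigr => a _; rewrite mul_mx_diag !mxE mulrAC.
have -> : (fun k => ((t *: A) ^+ k) i j / k`!%:R) =
   (fun k => \sum_a (invmx P i a * P a j) * exp_coeff (t * d 0 a) k).
  apply/funext => k; rewrite exprmxZ diag_power mxE mxE mulr_sumr mulr_suml.
  apply: eq_bigr => a _; rewrite mul_mx_diag !mxE exp_coeffE exprMn.
  ring.
exact: (@exp_diag_sum t (fun a => invmx P i a * P a j)).
Qed.

Lemma expmx_sqr t : expmx (t *: A) *m expmx (t *: A) = expmx ((2 * t) *: A).
Proof.
rewrite !expmx_diag !mulmxA mulmxK // -(mulmxA _ (diag_mx _) (diag_mx _)) mulmx_diag.
congr (_ *m diag_mx _ *m _); apply/rowP => a.
by rewrite !mxE -expRD; congr expR; ring.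
Qed.

Lemma mxtrace_expmx t : \tr (expmx (t *: A)) = \sum_a expR (t * d 0 a).
Proof.
rewrite expmx_diag mxtrace_mulC mulmxA mulmxV // mul1mx mxtrace_diag.
by apply: eq_bigr => a _; rewrite mxE.
Qed.

End Exponential.

Section ExpSym.
Variables (R : realType) (N : nat).
Implicit Types (A : 'M[R]_N).

Lemma trmx_expr A k : A^T = A -> (A ^+ k)^T = A ^+ k.
Proof.
move=> At; elim: k => [|k IH]; first by rewrite expr0 trmx1.
by rewrite exprS -mulmxE trmx_mul IH At [in RHS]mulmxE -exprS exprSr.
Qed.

Lemma trmx_expmx A t : A^T = A -> (expmx (t *: A))^T = expmx (t *: A).
Proof.
move=> At; apply/matrixP => i j; rewrite !mxE; congr (limn (series _)).
apply/funext => k; rewrite -[in RHS](@trmx_expr (t *: A)) ?mxE //.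
by rewrite linearZ /= At.
Qed.

Lemma expmx_fixed (P : 'M[R]_N) d t (o : 'cV[R]_N) : P \in unitmx ->
  invmx P *m diag_mx d *m P *m o = 0 ->
  expmx (t *: (invmx P *m diag_mx d *m P)) *m o = o.
Proof.
move=> Punit Ao; rewrite expmx_diag //.
have dP : diag_mx d *m (P *m o) = 0.
  by rewrite -[LHS](mulKVmx Punit) [invmx P *m _]mulmxA [X in _ *m X]mulmxA Ao mulmx0.
rewrite -!mulmxA -[RHS](mulKmx Punit); congr (_ *m _).
move: (P *m o) dP => w dw; apply/colP => a.
have /colP/(_ a) := dw; rewrite !mul_diag_mx !mxE => /eqP.
rewrite mulf_eq0 => /orP[/eqP->|/eqP->]; last by rewrite mulr0.
by rewrite mulr0 expR0 mul1r.
Qed.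

End ExpSym.

(** * Invariant row spaces *)

Section RowSpaces.
Variables (R : realType) (N : nat).
Implicit Types (P Q H : 'M[R]_N).

Lemma card_rows_leq_rank P H (I : {set 'I_N}) : P \in unitmx ->
  (forall a, a \in I -> (row a P <= H)%MS) -> (#|I| <= \rank H)%N.
Proof.
move=> Punit PH; pose f (i : 'I_#|I|) := enum_val i.
have rankf : \rank (rowsub f P) = #|I|.
  rewrite rowsubE mxrankMfree ?row_free_unit //; apply/eqP/row_freeP.
  exists (rowsub f 1%:M)^T; apply/matrixP=> i j.
  rewrite !mxE (bigD1 (f i)) //= !mxE eqxx mul1r big1 ?addr0.
    by rewrite (inj_eq enum_val_inj) eq_sym.
  by move=> k /negPf kf; rewrite !mxE eq_sym kf mul0r.
rewrite -[X in (X <= _)%N]rankf; apply/mxrankS/row_subP => i.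
by rewrite row_rowsub PH ?enum_valP.
Qed.

Lemma rank_span_leq (T : finType) (p : pred T) (w : T -> 'rV[R]_N) :
  (\rank (\sum_(g | p g) <<w g>>)%MS <= #|p|)%N.
Proof.
rewrite -sum1_card; apply: (big_ind2 (fun (M : 'M[R]_N) r => \rank M <= r)%N).
- by rewrite mxrank0.
- move=> M1 r1 M2 r2 h1 h2.
  exact: leq_trans (mxrank_adds_leqif _ _) (leq_add h1 h2).
- by move=> g _; rewrite mxrank_gen rank_leq_row.
Qed.

Lemma dot_eq0 (v : 'rV[R]_N) : (v *m v^T == 0) = (v == 0).
Proof.
apply/eqP/eqP => [|->]; last by rewrite mul0mx.
move/matrixP/(_ 0 0); rewrite !mxE => /eqP; rewrite psumr_eq0; last first.
  by move=> i _; rewrite mxE -expr2 sqr_ge0.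
move=> /allP v0; apply/rowP => i; rewrite !mxE.
by have := v0 i (mem_index_enum i); rewrite mxE -expr2 sqrf_eq0 => /eqP.
Qed.

(** Since [Q] is symmetric, the orthogonal complement of the invariant space [H]
    is invariant too, so the component of [u] orthogonal to [H] is again an
    eigenvector: it plays the role of the image of [u] in the quotient by [H]. *)
Lemma orthogonal_component Q H (u : 'rV[R]_N) (r : R) : Q^T = Q ->
  (H *m Q <= H)%MS -> u *m Q = r *: u -> ~~ (u <= H)%MS ->
  exists v : 'rV[R]_N, [/\ v *m Q = r *: v, v *m H^T = 0 & v *m u^T != 0].
Proof.
move=> Qsym HQ uQ uH; pose K := kermx H^T.
have HK0 (v : 'rV[R]_N) : (v <= H)%MS -> v *m H^T = 0 -> v = 0.
  move=> /submxP[D vD] vH; apply/eqP; rewrite -dot_eq0 {2}vD trmx_mul.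
  by rewrite mulmxA vH mul0mx.
have full : (u <= (H + K)%MS)%MS.
  apply: submx_full; rewrite /row_full eqn_leq rank_leq_col /=.
  have := (mxrank_sum_cap H K); rewrite mxrank_ker mxrank_tr subnKC ?rank_leq_row //.
  suff -> : (H :&: K)%MS = 0 by rewrite mxrank0 addn0 => ->.
  apply/eqP; rewrite -submx0; apply/rV_subP => v; rewrite sub_capmx.
  by move=> /andP[vH /sub_kermxP vK]; rewrite (HK0 _ vH vK) sub0mx.
have [[D E] /= uE] := sub_addsmxP full.
pose v := E *m K; pose h := D *m H.
have vH : v *m H^T = 0 by apply/sub_kermxP; rewrite submxMl.
have hH : (h <= H)%MS by rewrite submxMl.
have uhv : u = h + v by [].
have vQ : v *m Q = r *: v.
  apply/eqP; rewrite -subr_eq0; apply/eqP/HK0.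
    have -> : v *m Q - r *: v = r *: h - h *m Q.
      have := uQ; rewrite uhv mulmxDl scalerDr => /(canRL (addKr _)) ->.
      by rewrite addrA addrK addrC.
    by rewrite addmx_sub ?scalemx_sub// eqmx_opp (submx_trans _ HQ)// submxMr.
  have /submxP[X HX] := HQ.
  rewrite mulmxBl -scalemxAl vH scaler0 subr0 -mulmxA -{1}Qsym -trmx_mul HX.
  by rewrite trmx_mul mulmxA vH mul0mx.
exists v; split => //.
have -> : v *m u^T = v *m v^T.
  rewrite uhv linearD mulmxDr /= /h trmx_mul mulmxA vH mul0mx add0r //.
rewrite dot_eq0; apply: contra uH => /eqP v0.
by rewrite uhv v0 addr0.
Qed.

End RowSpaces.

Section Multiplicity.
Variables (R : realType) (N : nat) (P : 'M[R]_N) (d : 'rV[R]_N).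
Hypothesis Punit : P \in unitmx.
Let Q := invmx P *m diag_mx d *m P.

Lemma row_eigen a : row a P *m Q = d 0 a *: row a P.
Proof.
rewrite /Q -row_mul !mulmxA mulmxV // mul1mx.
by apply/rowP => i; rewrite mxE mul_diag_mx !mxE.
Qed.

(** In the eigenbasis [P], an eigenvector for [r] has coordinates only on the rows
    of [P] whose eigenvalue is [r]. *)
Lemma rank_eigen_leq m (E : 'M[R]_(m, N)) (r : R) : E *m Q = r *: E ->
  (\rank E <= #|[pred a | d 0%R a == r]|)%N.
Proof.
move=> EQ; pose X := E *m invmx P.
have XD : X *m diag_mx d = r *: X.
  by rewrite /X scalemxAl -EQ /Q !mulmxA mulmxK.
have X0 i a : d 0 a != r -> X i a = 0.
  move=> dr; have /matrixP/(_ i a) := XD; rewrite mul_mx_diag mxE [RHS]mxE => /eqP.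
  rewrite mulrC -subr_eq0 -mulrBl mulf_eq0 subr_eq0 (negPf dr) /=.
  by move/eqP.
apply: leq_trans (rank_span_leq [pred a | d 0 a == r] (fun a => row a P)).
apply/mxrankS/row_subP => i.
have -> : row i E = \sum_a X i a *: row a P.
  rewrite -[E in LHS](mulmxKV Punit) -/X row_mul; apply/rowP => j.
  by rewrite !mxE summxE; apply: eq_bigr => a _; rewrite !mxE.
apply: summx_sub => a _; have [da|da] := eqVneq (d 0 a) r.
  by apply/scalemx_sub/(sumsmx_sup a); rewrite ?inE ?da // genmxE.
by rewrite X0 // scale0r sub0mx.
Qed.

End Multiplicity.

(** * The process as an action of transpositions *)

Section Moves.
Variables (n l : nat).
Implicit Types (x y : lep_state n l) (s : 'S_n).

Definition pos x (j : 'I_l) : 'I_n := tnth (val x) j.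

Lemma pos_inj x : injective (pos x).
Proof. by move=> i j /(tuple_uniqP (val x) (valP x)). Qed.

Lemma state_eq x y : pos x =1 pos y -> x = y.
Proof. by move=> e; apply/val_inj/eq_from_tnth. Qed.

Lemma move_uniq s x : uniq (map_tuple s (val x)).
Proof. by rewrite map_inj_uniq ?(valP x) //; apply: perm_inj. Qed.

Definition move s x : lep_state n l := exist _ (map_tuple s (val x)) (move_uniq s x).

Lemma pos_move s x j : pos (move s x) j = s (pos x j).
Proof. by rewrite /pos tnth_map. Qed.

Lemma move_inj s : injective (move s).
Proof.
by move=> x y e; apply: state_eq => j; apply: (@perm_inj _ s); rewrite -!pos_move e.
Qed.

Definition neighbors x y := differ_in_one x y || interchanged x y.

Lemma neighborsC x y : neighbors x y = neighbors y x.
Proof.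
congr (_ || _).
  by congr (_ == _); apply: eq_card => j; rewrite !inE eq_sym.
have sub a b : interchanged a b -> interchanged b a.
  move=> /existsP[i /existsP[j /andP[ij /forallP e]]].
  apply/existsP; exists i; apply/existsP; exists j; rewrite ij /=.
  by apply/forallP => k; rewrite (eqP (e _)) tpermK.
by apply/idP/idP => /sub.
Qed.

Lemma move_tperm_eq x y (j : 'I_l) (u v : 'I_n) : pos x j != pos y j ->
  move (tperm u v) x = y ->
  (u, v) = (pos x j, pos y j) \/ (u, v) = (pos y j, pos x j).
Proof.
move=> jxy /(congr1 (pos^~ j)); rewrite pos_move.
by case: tpermP => [-> <-|-> <-|_ _ e]; [left|right|rewrite e eqxx in jxy].
Qed.

Lemma neighborsP x y (j : 'I_l) : pos x j != pos y j ->
  neighbors x y = (move (tperm (pos x j) (pos y j)) x == y).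
Proof.
move=> jxy; apply/idP/eqP => [/orP[/cards1P[i Ei]|]|e].
- have Di k : (pos x k != pos y k) = (k == i).
    have : (k \in [set i]%SET) = (k == i) by rewrite finset.in_set1.
    by rewrite -Ei inE.
  have ij : i = j by apply/eqP; rewrite eq_sym -Di.
  subst i; apply: state_eq => k; rewrite pos_move.
  have [->|kj] := eqVneq k j; first by rewrite tpermL.
  have xyk : pos x k = pos y k by apply/eqP/negPn; rewrite Di.
  rewrite tpermD //; first by rewrite (inj_eq (@pos_inj x)) eq_sym.
  by rewrite xyk (inj_eq (@pos_inj y)) eq_sym.
- move=> /existsP[a /existsP[b /andP[ab /forallP e]]].
  have {}e k : pos y k = pos x (tperm a b k) by apply/eqP/e.
  apply: state_eq => k; rewrite pos_move !e.
  move: jxy; rewrite e; case: (tpermP a b j) => [-> _|-> _|]; last by rewrite eqxx.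
    case: (tpermP a b k) => [->|->|/eqP ka /eqP kb]; rewrite ?tpermL ?tpermR //.
    by rewrite tpermD // (inj_eq (@pos_inj x)) eq_sym.
  case: (tpermP a b k) => [->|->|/eqP ka /eqP kb]; rewrite ?tpermL ?tpermR //.
  by rewrite tpermD // (inj_eq (@pos_inj x)) eq_sym.
- have py k : pos y k = tperm (pos x j) (pos y j) (pos x k) by rewrite -pos_move e.
  apply/orP; case: (pickP (fun i => pos x i == pos y j)) => [i /eqP xi|no].
    right; apply/existsP; exists i; apply/existsP; exists j.
    have ij : i != j by apply: contra jxy => /eqP ij; rewrite -xi ij.
    rewrite ij /=; apply/forallP => k; rewrite -![tnth _ _]/(pos _ _) py -xi.
    case: (tpermP i j k) => [->|->|/eqP ki /eqP kj]; rewrite ?tpermL ?tpermR //.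
    by rewrite tpermD // (inj_eq (@pos_inj x)) eq_sym.
  left; apply/cards1P; exists j; apply/setP => k.
  rewrite !inE -![tnth _ _]/(pos _ _) [in X in _ != X]py.
  have [->|kj] := eqVneq k j; first by rewrite tpermL.
  rewrite tpermD ?eqxx //; first by rewrite (inj_eq (@pos_inj x)) eq_sym.
  by rewrite eq_sym no.
Qed.

(** Each possible jump is realised by a single transposition, which is counted
    twice because the pair of its vertices is ordered. *)
Lemma card_tperm_move x y : x != y ->
  #|[set p : 'I_n * 'I_n | move (tperm p.1 p.2) x == y]%SET| = (2 * neighbors x y)%N.
Proof.
move=> xy; have [j jxy] : exists j, pos x j != pos y j.
  apply/existsP; apply: contraR xy; rewrite negb_exists => /forallP e.
  by apply/eqP/state_eq => j; apply/eqP/negPn.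
rewrite (neighborsP jxy); case: eqP => [e|ne].
  rewrite (_ : finset _ = [set (pos x j, pos y j); (pos y j, pos x j)]%SET).
    by rewrite cards2 xpair_eqE (negPf jxy).
  apply/setP=> -[u v]; rewrite !inE /=; apply/eqP/orP => [|[/eqP[-> ->]|/eqP[-> ->]]].
  - by move=> /(move_tperm_eq jxy)[] ->; [left|right].
  - by [].
  - by rewrite tpermC.
apply/eqP; rewrite cards_eq0; apply/eqP/setP => -[u v]; rewrite !inE /=.
apply/eqP => e; apply: ne; move: (move_tperm_eq jxy e) => -[[eu ev]|[eu ev]].
  by rewrite -eu -ev.
by rewrite tpermC -eu -ev.
Qed.

Lemma card_occupied x : #|[set pos x j | j in 'I_l]%SET| = l.
Proof. by rewrite card_imset ?card_ord //; apply: pos_inj. Qed.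

Lemma card_tperm_moving x :
  #|[set p : 'I_n * 'I_n | move (tperm p.1 p.2) x != x]%SET|
    = (2 * (l * (n - l) + 'C(l, 2)))%N.
Proof.
pose B := [set pos x j | j in 'I_l]%SET.
have cB : #|B| = l := card_occupied x.
have ln : (l <= n)%N by rewrite -cB -[n in (_ <= n)%N]card_ord max_card.
(* A transposition of two distinct vertices moves the state unless both vertices
   are empty, so [D] and the diagonal pairs at occupied vertices make up the pairs
   that meet an occupied vertex. *)
set D := finset _.
have E : (D :|: [set (u, u) | u in B] = ~: finset.setX (~: B) (~: B))%SET.
  apply/setP => -[u v]; rewrite !inE /= -negb_or !negbK.
  have [->|uv] := eqVneq u v.
    rewrite tperm1 orbb (_ : move 1 x = x) ?eqxx /=.
      apply/imsetP/idP => [[w wB [-> _]]//|vB]; by exists v.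
    by apply: state_eq => j; rewrite pos_move perm1.
  rewrite [X in _ || X](_ : _ = false) ?orbF; last first.
    by apply/imsetP => -[w _ [uw vw]]; rewrite uw vw eqxx in uv.
  apply/idP/idP => [|/orP[]/imsetP[j _ ej]].
  - apply: contraR => /norP[uB vB]; apply/eqP/state_eq => j; rewrite pos_move.
    by rewrite tpermD //; [move: uB|move: vB]; apply: contra => /eqP->; apply: imset_f.
  - apply: contra uv => /eqP/(congr1 (pos^~ j)); rewrite pos_move -ej tpermL.
    by move=> ->.
  - apply: contra uv => /eqP/(congr1 (pos^~ j)); rewrite pos_move -ej tpermR.
    by move=> ->.
have dis : (D :&: [set (u, u) | u in B] = finset.set0)%SET.
  apply/setP => -[u v]; rewrite !inE /=; apply/negP => /andP[h /imsetP[w _ [uw vw]]].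
  move: h; rewrite uw vw tperm1 => /negP; apply; apply/eqP/state_eq => j.
  by rewrite pos_move perm1.
have cC : #|~: B| = (n - l)%N by rewrite cardsCs finset.setCK card_ord cB.
have := cardsUI D [set (u, u) | u in B]%SET.
rewrite E dis cards0 addn0 card_imset; last by move=> u v [].
rewrite cardsCs finset.setCK cardsX card_prod !card_ord cC cB.
have := mul_bin_diag l 1; rewrite bin1.
move: #|D| 'C(l, 2) => d b h1 h2; clear -ln h1 h2.
by nia.
Qed.

End Moves.

Section Generator.
Variables (R : realType) (n l : nat) (alpha : R).
Implicit Types (x y : lep_state n l).

Lemma lep_generatorC x y : lep_generator alpha x y = lep_generator alpha y x.
Proof.
rewrite /lep_generator -/(neighbors x y) -/(neighbors y x) (neighborsC x) [x == y]eq_sym.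
by case: eqP => // ->.
Qed.

(** The factor [1 / 2] compensates for the ordered pairs; the diagonal pairs
    [u = v] contribute nothing. *)
Lemma lep_generator_tperm (f : lep_state n l -> R) x :
  \sum_y lep_generator alpha x y * f y =
    alpha / 2 * \sum_u \sum_v (f (move (tperm u v) x) - f x).
Proof.
have S2 (F : lep_state n l -> R) : \sum_u \sum_v (F (move (tperm u v) x) - F x) =
    \sum_(y | y != x) (2 * neighbors x y)%:R * (F y - F x).
  rewrite pair_bigA /= (partition_big (fun p => move (tperm p.1 p.2) x) xpredT) //=.
  rewrite (bigD1 x) //= big1 ?add0r => [|p /eqP->]; last by rewrite subrr.
  apply: eq_bigr => y yx.
  rewrite -card_tperm_move 1?eq_sym //.
  rewrite (eq_bigr (fun=> F y - F x)) => [|p /eqP -> //].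
  by rewrite sumr_const mulr_natl; congr (_ *+ _); apply: eq_card => p; rewrite !inE.
have cnt : (l * (n - l) + 'C(l, 2))%:R = \sum_(y | y != x) (neighbors x y)%:R :> R.
  have := S2 (fun y => (y != x)%:R).
  rewrite pair_bigA /= (eq_bigr (fun p => if move (tperm p.1 p.2) x != x then 1 else 0));
    last by move=> p _; rewrite eqxx subr0; case: ifP.
  rewrite -big_mkcond /= sumr_const.
  rewrite (_ : #|_| = #|[set p : 'I_n * 'I_n | move (tperm p.1 p.2) x != x]%SET|);
    last by apply: eq_card => p; rewrite !inE.
  rewrite card_tperm_moving natrM => E.
  apply: (@mulfI _ (2%:R : R)); first by rewrite pnatr_eq0.
  rewrite E mulr_sumr; apply: eq_bigr => y ->; by rewrite eqxx subr0 mulr1 natrM.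
rewrite S2 (bigD1 x) //= {1}/lep_generator eqxx cnt -mulNr mulr_sumr mulr_suml.
rewrite -big_split mulr_sumr /=; apply: eq_bigr => y yx.
rewrite /lep_generator eq_sym (negPf yx) -/(neighbors x y) natrM.
have h2 : alpha / 2 * 2%:R = alpha by rewrite mulfVK ?pnatr_eq0.
by case: neighbors; rewrite ?mulr1 ?mulr0 ?mul0r ?mulr0 ?oppr0 ?addr0 //
  mulrA h2; ring.
Qed.

End Generator.

Section Homogeneity.
Variables (R : realType) (n l : nat) (alpha : R).
Let T : finType := lep_state n l.

Lemma expr_reindex N (A : 'M[R]_N) (s : 'I_N -> 'I_N) : bijective s ->
  (forall i j, A (s i) (s j) = A i j) ->
  forall k i j, (A ^+ k) (s i) (s j) = (A ^+ k) i j.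
Proof.
move=> sb sA; elim=> [|k IH] i j.
  by rewrite expr0 !mxE (bij_eq sb).
rewrite !exprS -!mulmxE !mxE (reindex s) /=; last exact: onW_bij.
by apply: eq_bigr => a _; rewrite sA IH.
Qed.

Lemma generator_move s (x y : T) :
  lep_generator alpha (move s x) (move s y) = lep_generator alpha x y.
Proof.
have Ed : differ_in_one (move s x) (move s y) = differ_in_one x y.
  rewrite /differ_in_one; congr (_ == _); apply: eq_card => j; rewrite !inE.
  by rewrite -![tnth _ _]/(pos _ _) !pos_move (inj_eq (@perm_inj _ s)).
have Ei : interchanged (move s x) (move s y) = interchanged x y.
  apply: eq_existsb => i; apply: eq_existsb => j; congr (_ && _).
  apply: eq_forallb => k.
  by rewrite -![tnth _ _]/(pos _ _) !pos_move (inj_eq (@perm_inj _ s)).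
by rewrite /lep_generator (inj_eq (@move_inj _ _ s)) Ed Ei.
Qed.

(** The relabelling is built one ball at a time: once the first [m] balls are in
    place, a transposition of vertices not used by them places the next one. *)
Lemma move_transitive (x y : T) : exists s, move s x = y.
Proof.
suff H m : exists s : 'S_n, forall j : 'I_l, (j < m)%N -> s (pos x j) = pos y j.
  by have [s Hs] := H l; exists s; apply: state_eq => j; rewrite pos_move Hs.
elim: m => [|m [s Hs]]; first by exists 1%g.
have [lm|ml] := leqP l m.
  by exists s => j _; apply: Hs; apply: leq_trans lm.
pose j0 := Ordinal ml.
exists (s * tperm (s (pos x j0)) (pos y j0))%g => j; rewrite ltnS leq_eqVlt permM.
move=> /orP[/eqP jm|jm].
  by rewrite (_ : j = j0) ?tpermL //; apply: val_inj.
have jj : j0 != j by rewrite -val_eqE /= gtn_eqF.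
rewrite (Hs _ jm) tpermD //; last by rewrite (inj_eq (@pos_inj _ _ y)).
by rewrite -(Hs _ jm) (inj_eq (@perm_inj _ s)) (inj_eq (@pos_inj _ _ x)).
Qed.

Lemma transition_diag t (x y : T) :
  transition (@lep_generator R n l alpha) t x x =
  transition (@lep_generator R n l alpha) t y y.
Proof.
have [s <-] := move_transitive x y.
pose f (i : 'I_#|T|) := enum_rank (move s (enum_val i)).
have fb : bijective f.
  by apply: injF_bij => i j /enum_rank_inj/move_inj/enum_val_inj.
have fQ i j : (t *: kernel_mx (@lep_generator R n l alpha)) (f i) (f j)
   = (t *: kernel_mx (@lep_generator R n l alpha)) i j.
  by rewrite !mxE !enum_rankK generator_move.
rewrite /transition !mxE; congr (limn (series _)); apply/funext => k.
by rewrite -(expr_reindex fb fQ) /f enum_rankK.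
Qed.

End Homogeneity.

(** * Cylinder functions and their levels *)

Section Cylinders.
Variables (R : realType) (n l : nat).
Implicit Types (x y : lep_state n l).

(** A pattern prescribes the positions of some of the balls; its level is the
    number of balls concerned.  Patterns prescribing the same vertex to two balls
    are allowed, and are matched by no state: this is what makes the sum over
    all positions of a ball, in [sum_place], collapse. *)
Definition pattern := {ffun 'I_l -> option 'I_n}.
Implicit Types (g : pattern).

Definition matches g x := [forall j, if g j is Some v then pos x j == v else true].

Definition level g := #|[set j | g j != None]%SET|.

Definition move_pattern (s : 'S_n) g : pattern := [ffun j => omap s (g j)].
Definition erase g j : pattern := [ffun i => if i == j then None else g i].
Definition place g j v : pattern := [ffun i => if i == j then Some v else g i].

Lemma matches_move u v g x :
  matches g (move (tperm u v) x) = matches (move_pattern (tperm u v) g) x.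
Proof.
apply: eq_forallb => j; rewrite pos_move ffunE; case: (g j) => //= w.
by rewrite -[w in LHS](tpermK u v) (inj_eq (@perm_inj _ _)).
Qed.

Lemma level_move s g : level (move_pattern s g) = level g.
Proof. by apply: eq_card => j; rewrite !inE ffunE; case: (g j). Qed.

Lemma level_erase g j : g j != None -> (level (erase g j)).+1 = level g.
Proof.
move=> gj; rewrite /level (cardsD1 j [set j | g j != None]%SET) inE gj add1n.
by congr (_.+1); apply: eq_card => i; rewrite !inE ffunE; have [->|] := eqVneq i j.
Qed.

Lemma sum_place g j x :
  \sum_v (matches (place g j v) x)%:R = (matches (erase g j) x)%:R :> R.
Proof.
have E v : matches (place g j v) x = (pos x j == v) && matches (erase g j) x.
  apply/forallP/andP => [H|[jv /forallP H] i].
    split; first by have := H j; rewrite ffunE eqxx.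
    by apply/forallP => i; have := H i; rewrite !ffunE; case: eqP.
  by have := H i; rewrite !ffunE; case: eqP => [->|].
rewrite (bigD1 (pos x j)) //= big1 ?addr0 ?E ?eqxx // => v vj.
by rewrite E eq_sym (negPf vj).
Qed.

Lemma matches_collision g i j v x : i != j -> g i = Some v -> g j = Some v ->
  matches g x = false.
Proof.
move=> ij gi gj; apply/forallP => H; have := H i; have := H j.
rewrite gi gj => /eqP <- /eqP/pos_inj e; by rewrite e eqxx in ij.
Qed.

End Cylinders.
Arguments pattern n l : clear implicits.

(** The function [phi] below stands for [g |-> <v, 1_g>], where [1_g] is the
    indicator of the pattern [g] and [v] is a vector orthogonal to all indicators
    of level [k - 1]. *)
Section TopLevel.
Variables (R : realType) (n l k : nat) (phi : pattern n l -> R).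
Hypothesis phi_place : forall g j, \sum_v phi (place g j v) = phi (erase g j).
Hypothesis phi_collision : forall (g : pattern n l) i j v,
  i != j -> g i = Some v -> g j = Some v -> phi g = 0.
Hypothesis phi_lower : forall g : pattern n l, (level g).+1 = k -> phi g = 0.
Variable g : pattern n l.
Hypothesis gk : level g = k.
Hypothesis phig : phi g != 0.
Hypothesis phi_max : forall g' : pattern n l, level g' = k -> `|phi g'| <= `|phi g|.

Let B := [set v | [exists j, g j == Some v]]%SET.

Lemma place_self j u : g j = Some u -> place g j u = g.
Proof. by move=> gj; apply/ffunP => i; rewrite ffunE; case: eqP => [->|]. Qed.

Lemma card_image : #|B| = k.
Proof.
have BE : (Some @: B = g @: [set j | g j != None])%SET.
  apply/setP => -[v|]; last first.
    apply/imsetP/imsetP => -[] // j; by rewrite inE => /negP h /esym/eqP.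
  apply/imsetP/imsetP => [[w]|[j]]; rewrite inE.
    by move=> /existsP[j /eqP gj] [->]; exists j; rewrite ?inE gj.
  by move=> _ gj; exists v => //; rewrite inE; apply/existsP; exists j; rewrite gj.
rewrite -gk /level -(card_imset _ (@Some_inj _)) BE card_in_imset //.
move=> i j; rewrite !inE; case gi : (g i) => [v|] // _ _ gj.
apply/eqP; apply: contraNT phig => ij.
by rewrite (phi_collision ij gi (esym gj)).
Qed.

(** The change of [phi] under a transposition, multiplied by [phi g] so that the
    maximum principle holds for either sign of [phi g]. *)
Let D u v := phi g * phi (move_pattern (tperm u v) g) - phi g ^+ 2.

Lemma D_le0 u v : D u v <= 0.
Proof.
rewrite subr_le0 (le_trans (ler_norm _)) // normrM -real_normK ?num_real // expr2.
by rewrite ler_wpM2l // phi_max // level_move.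
Qed.

(** Moving the ball at [u] to a vertex [v] outside [B] amounts to placing it at
    [v].  The sum over all [v] vanishes by orthogonality to the lower level, the
    other vertices of [B] give collisions, and so only [v = u] is missing. *)
Lemma D_row u : u \in B ->
  \sum_(v | v \notin B) D u v = - ((n - k).+1%:R * phi g ^+ 2).
Proof.
rewrite inE => /existsP[j /eqP gj].
have move_place v : v \notin B -> move_pattern (tperm u v) g = place g j v.
  rewrite inE negb_exists => /forallP vB; apply/ffunP => i; rewrite !ffunE.
  have [->|ij] := eqVneq i j; first by rewrite gj /= tpermL.
  case gi : (g i) => [w|] //=; rewrite tpermD //.
    by apply: contraNneq phig => uw; rewrite (phi_collision ij gi (v := w)) // gj uw.
  by apply: contraNneq (vB i) => ->; rewrite gi.
have sum0 : \sum_(v | v \notin B) phi (place g j v) = - phi g.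
  have := phi_place g j; rewrite phi_lower ?level_erase ?gj ?gk // => /eqP.
  rewrite (bigID (mem B)) /= addrC addr_eq0 => /eqP ->; congr (- _).
  rewrite (bigD1 u) ?inE /=; last by apply/existsP; exists j; rewrite gj.
  rewrite (place_self gj) big1 ?addr0 // => v /andP[+ vu].
  rewrite inE => /existsP[i /eqP gi].
  have ij : i != j by apply: contra_neq vu => e; move: gi; rewrite e gj => -[].
  by apply: (phi_collision ij (v := v)); rewrite ffunE ?eqxx // (negPf ij).
rewrite sumrB sumr_const.
rewrite (_ : #|_| = (n - k)%N); last first.
  have := cardC (mem B); rewrite card_ord card_image => e.
  by rewrite -[X in (X - _)%N]e addKn.
under eq_bigr => v vB do rewrite (move_place _ vB).
by rewrite -mulr_sumr sum0 -mulr_natl -natr1; ring.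
Qed.

(** Pairs with exactly one vertex in [B] are evaluated by [D_row]; those with both
    vertices in [B] interchange two balls and contribute at most zero since
    [phi] is maximal in absolute value at [g]. *)
Lemma top_level_sum :
  \sum_u \sum_v D u v <= - (2 * (k * (n - k).+1)%:R * phi g ^+ 2).
Proof.
have DC u v : D u v = D v u by rewrite /D tpermC.
have S : \sum_(u in B) \sum_(v | v \notin B) D u v
    = - ((k * (n - k).+1)%:R * phi g ^+ 2).
  under eq_bigr => u uB do rewrite D_row //.
  by rewrite sumr_const card_image natrM -mulr_natl; ring.
rewrite (bigID (mem B)) /= (_ : - _ = - ((k * (n - k).+1)%:R * phi g ^+ 2)
   + - ((k * (n - k).+1)%:R * phi g ^+ 2)); last by ring.
rewrite -{1}S -{1}S; apply: lerD.
  apply: ler_sum => u uB; rewrite [leLHS](bigID (mem B)) /= gerDr.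
  by apply: sumr_le0 => v _; apply: D_le0.
rewrite [leRHS]exchange_big; apply: ler_sum => v vB.
rewrite [leLHS](bigID (mem B)) /= (eq_bigr (D^~ v)) => [|u _]; last exact: DC.
by rewrite gerDl; apply: sumr_le0 => u _; apply: D_le0.
Qed.

End TopLevel.

(** * The spectrum of the generator *)

Section Spectrum.
Variables (R : realType) (n l : nat) (alpha : R).
Let T : finType := lep_state n l.
Let N := #|T|.
Let Q : 'M[R]_N := kernel_mx (@lep_generator R n l alpha).
Implicit Types (g : pattern n l) (u v : 'rV[R]_N).

Definition cyl g : 'rV[R]_N := \row_i (matches g (enum_val i))%:R.

Definition cyl_span (p : pred (pattern n l)) : 'M[R]_N :=
  (\sum_(g | p g) <<cyl g>>)%MS.

Definition level_span k := cyl_span (fun g => level g == k).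

(** Written with a successor so that it is the zero space for [k = 0]. *)
Definition lower_span k := cyl_span (fun g => (level g).+1 == k).

Lemma generator_sym : Q^T = Q.
Proof. by apply/matrixP => i j; rewrite !mxE lep_generatorC. Qed.

Lemma cyl_generator g : cyl g *m Q =
  (alpha / 2) *: (\sum_u \sum_v (cyl (move_pattern (tperm u v) g) - cyl g)).
Proof.
apply/rowP => i; rewrite !mxE summxE.
rewrite (eq_bigr (fun j : 'I_N => lep_generator alpha (enum_val i) (enum_val j)
   * (matches g (enum_val j))%:R)) => [|j _]; last first.
  by rewrite !mxE mulrC lep_generatorC.
rewrite -(reindex (enum_val : 'I_#|T| -> T) (P := xpredT)
   (F := fun y => lep_generator alpha (enum_val i) y * (matches g y)%:R)) /=; last first.
  by apply: onW_bij; apply: enum_val_bij.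
rewrite lep_generator_tperm; congr (_ * _); apply: eq_bigr => u _.
by rewrite summxE; apply: eq_bigr => v _; rewrite !mxE matches_move.
Qed.

Lemma cyl_sub (p : pred (pattern n l)) g : p g -> (cyl g <= cyl_span p)%MS.
Proof. by move=> pg; apply: (sumsmx_sup g) => //; rewrite genmxE. Qed.

Lemma cyl_span_stable (p : pred (pattern n l)) :
  (forall s g, p (move_pattern s g) = p g) -> (cyl_span p *m Q <= cyl_span p)%MS.
Proof.
move=> pm; rewrite sumsmxMr; apply/sumsmx_subP => g pg.
have -> : (<<cyl g>> *m Q <= cyl_span p)%MS = (cyl g *m Q <= cyl_span p)%MS.
  by rewrite (eqmxMr _ (genmxE _)).
rewrite cyl_generator scalemx_sub // summx_sub // => u _; rewrite summx_sub // => v _.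
by rewrite addmx_sub ?eqmx_opp ?cyl_sub ?pm.
Qed.

Lemma cyl_place g j : \sum_v cyl (place g j v) = cyl (erase g j).
Proof.
by apply/rowP => i; rewrite summxE mxE -sum_place; apply: eq_bigr => v _; rewrite mxE.
Qed.

Hypothesis alpha_ge0 : 0 <= alpha.

(** Pair the component [v] of [u] orthogonal to the lower level with the cylinder
    functions of level [k], and evaluate the eigenvalue equation at a pattern
    where this pairing is largest in absolute value. *)
Lemma eigenvalue_level u (r : R) k : u *m Q = r *: u ->
  (u <= level_span k)%MS ->
  ~~ (u <= lower_span k)%MS ->
  r <= - (alpha * (k * (n - k).+1)%:R).
Proof.
move=> uQ uk ulow.
have stable : (lower_span k *m Q <= lower_span k)%MS.
  by apply: cyl_span_stable => s g; rewrite level_move.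
have [v [vQ vlow vu]] := orthogonal_component generator_sym stable uQ ulow.
pose phi g := (cyl g *m v^T) 0 0.
have lower g : (level g).+1 = k -> phi g = 0.
  move=> gk; have /submxP[D cD] : (cyl g <= lower_span k)%MS.
    by apply: cyl_sub; apply/eqP.
  by rewrite /phi cD -mulmxA -[_ *m v^T]trmxK trmx_mul trmxK vlow trmx0 mulmx0 mxE.
have [g0 g0k phi0] : exists2 g, level g == k & phi g != 0.
  apply/exists_inP; apply: contraNT vu; rewrite negb_exists_in => /forall_inP z.
  rewrite -[_ == 0](inj_eq (@trmx_inj _ _ _)) trmx0 trmx_mul trmxK.
  apply/eqP/sub_kermxP; apply: submx_trans uk _; apply/sumsmx_subP => g gk.
  rewrite genmxE; apply/sub_kermxP/matrixP => i j; rewrite !ord1 [RHS]mxE.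
  by apply/eqP; rewrite -[_ == _]negbK z.
have [g gk gmax] := @arg_maxP _ _ _ g0 (fun g => level g == k) (fun g => `|phi g|) g0k.
have phig : phi g != 0.
  by rewrite -normr_gt0 (lt_le_trans _ (gmax _ g0k)) // normr_gt0.
have place_phi g' j : \sum_w phi (place g' j w) = phi (erase g' j).
  rewrite /phi -cyl_place mulmx_suml summxE //.
have coll (g' : pattern n l) i j w : i != j -> g' i = Some w -> g' j = Some w -> phi g' = 0.
  move=> ij gi gj; rewrite /phi (_ : cyl g' = 0) ?mul0mx ?mxE //.
  by apply/rowP => m; rewrite !mxE (matches_collision _ ij gi gj).
have := top_level_sum place_phi coll lower (eqP gk) phig.
move=> /(_ (fun g' g'k => gmax g' (introT eqP g'k))) top.
have eig : r * phi g ^+ 2 = alpha / 2 * \sum_u \sum_v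
    (phi g * phi (move_pattern (tperm u v) g) - phi g ^+ 2).
  have e : r * phi g =
      alpha / 2 * \sum_u \sum_v (phi (move_pattern (tperm u v) g) - phi g).
    have -> : r * phi g = (cyl g *m Q *m v^T) 0 0.
      rewrite -mulmxA -[Q]generator_sym -trmx_mul vQ linearZ /= -scalemxAr.
      by rewrite [RHS]mxE.
    rewrite cyl_generator -scalemxAl mxE; congr (_ * _).
    rewrite mulmx_suml summxE; apply: eq_bigr => a _.
    rewrite mulmx_suml summxE; apply: eq_bigr => b _.
    by rewrite mulmxBl mxE [X in _ + X]mxE.
  rewrite expr2 mulrA e -mulrA; congr (_ * _).
  rewrite mulr_suml; apply: eq_bigr => a _; rewrite mulr_suml; apply: eq_bigr => b _.
  by ring.
have p2 : 0 < phi g ^+ 2 by rewrite exprn_even_gt0.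
rewrite -(ler_pM2r p2) eig.
have : alpha / 2 * (\sum_u \sum_v
    (phi g * phi (move_pattern (tperm u v) g) - phi g ^+ 2)) <=
   alpha / 2 * - (2 * (k * (n - k).+1)%:R * phi g ^+ 2).
  by rewrite ler_wpM2l // divr_ge0.
by move/le_trans; apply; rewrite le_eqVlt; apply/orP; left; apply/eqP; field.
Qed.

Lemma cyl_span_top : (1%:M <= level_span l)%MS.
Proof.
apply/row_subP => i; rewrite row1.
pose g : pattern n l := [ffun j => Some (pos (enum_val i) j)].
have -> : delta_mx 0 i = cyl g.
  apply/rowP => j; rewrite !mxE eqxx /=; congr (nat_of_bool _)%:R.
  apply/eqP/forallP => [-> m|H]; first by rewrite ffunE.
  by apply/enum_val_inj/state_eq => m; have := H m; rewrite ffunE => /eqP.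
apply: cyl_sub; apply/eqP; rewrite -[RHS]card_ord -cardsT.
by apply: eq_card => j; rewrite !inE ffunE.
Qed.

(** Choose the balls, then their positions. *)
Lemma card_level k : (#|[pred g : pattern n l | level g == k]| <= 'C(l, k) * n ^ k)%N.
Proof.
rewrite -sum1_card.
rewrite (partition_big (fun g : pattern n l => [set j | g j != None]%SET)
   (fun A : {set 'I_l} => #|A| == k)) //=.
rewrite -[l in 'C(l, _)]card_ord -(card_draws _ k) -sum_nat_const.
rewrite (eq_bigl (fun A : {set 'I_l} => A \in [set A : {set 'I_l} | #|A| == k]%SET));
  last by move=> A; rewrite inE.
apply: leq_sum => A; rewrite inE => /eqP Ak.
rewrite sum1_card -[X in (_ <= X ^ _)%N](_ : #|predC1 (None : option 'I_n)| = n).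
  rewrite -Ak -(card_pffun_on None); apply/subset_leq_card/fintype.subsetP => g.
  rewrite inE => /andP[_ /eqP gA]; apply/pffun_onP; split.
    by apply/fintype.subsetP => j; rewrite -gA !inE.
  by move=> o /fintype.imageP[j jA ->]; move: jA; rewrite -gA !inE.
by rewrite cardC1 card_option card_ord.
Qed.

End Spectrum.

Section TraceBounds.
Variables (R : realType) (n l : nat) (alpha : R).
Let T : finType := lep_state n l.
Let N := #|T|.
Let Q : 'M[R]_N := kernel_mx (@lep_generator R n l alpha).
Variables (P : 'M[R]_N) (d : 'rV[R]_N).
Hypothesis Punit : P \in unitmx.
Hypothesis QE : Q = invmx P *m diag_mx d *m P.

(** Each eigenvector of the basis is assigned to the least level [k] whose span
    contains it.  At most [dim H_k <= C(l,k) n^k] of them are assigned to [k], and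
    their eigenvalues are controlled by [eigenvalue_level]. *)
Lemma trace_upper (s : R) : 0 <= alpha -> 0 <= s ->
  \sum_a expR (s * d 0 a) <=
  \sum_(k < l.+1) ('C(l, k) * n ^ k)%:R * expR (- (s * (alpha * (k * (n - k).+1)%:R))).
Proof.
move=> a0 s0.
have ex a : exists k, (row a P <= level_span R n l k)%MS.
  by exists l; apply: submx_trans (submx1 _) _; apply: cyl_span_top.
pose kap a := ex_minn (ex a).
have kap_in a : (row a P <= level_span R n l (kap a))%MS.
  by rewrite /kap; case: ex_minnP.
have kap_le a : (kap a < l.+1)%N.
  rewrite ltnS /kap; case: ex_minnP => m _; apply.
  by apply: submx_trans (submx1 _) _; apply: cyl_span_top.
have kap_ev a : d 0 a <= - (alpha * (kap a * (n - kap a).+1)%:R).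
  have eQ : row a P *m Q = d 0 a *: row a P by rewrite QE row_eigen.
  apply: (eigenvalue_level a0 eQ (kap_in a)).
  apply/negP => low; move: low; rewrite /kap; case: ex_minnP => [[|m] hm min].
    rewrite /lower_span /cyl_span big_pred0 // submx0 => /eqP r0.
    have /row_freeP[B PB] : row_free P by rewrite row_free_unit.
    have : row a (P *m B) = 0 by rewrite row_mul r0 mul0mx.
    rewrite PB => /rowP/(_ a); rewrite !mxE eqxx => /eqP.
    by rewrite oner_eq0.
  move=> low; have := min m; rewrite ltnn => h; apply: (notF); apply: h.
  move: low; rewrite /lower_span /level_span /cyl_span.
  by rewrite (eq_bigl (fun g : pattern n l => level g == m)).
rewrite (partition_big (fun a => Ordinal (kap_le a)) xpredT) //=.
apply: ler_sum => k _.
apply: (@le_trans _ _ (\sum_(a | Ordinal (kap_le a) == k)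
   expR (- (s * (alpha * (k * (n - k).+1)%:R))))).
  apply: ler_sum => a /eqP <-; rewrite ler_expR -mulrN; apply: ler_wpM2l => //.
rewrite sumr_const -[leLHS]mulr_natl ler_wpM2r ?expR_ge0 // ler_nat.
apply: leq_trans (card_level n l k).
rewrite -cardsE.
apply: leq_trans (card_rows_leq_rank (H := level_span R n l k) Punit _) _.
  by move=> a; rewrite inE => /eqP <-; apply: kap_in.
exact: rank_span_leq.
Qed.

Definition empty_pattern : pattern n l := [ffun=> None].

Lemma sum_tperm (V : zmodType) (F : 'I_n -> V) (w : 'I_n) :
  \sum_u \sum_v (F (tperm u v w) - F w) = (\sum_u (F u - F w)) *+ 2.
Proof.
rewrite (bigD1 w) //= mulr2n; congr (_ + _).
  by apply: eq_bigr => v _; rewrite tpermL.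
rewrite [RHS](bigD1 w) //= subrr add0r; apply: eq_bigr => u uw.
rewrite (bigD1 w) //= tpermR big1 ?addr0 // => v vw.
by rewrite tpermD // subrr.
Qed.

Lemma empty_generator : cyl R empty_pattern *m Q = 0.
Proof.
rewrite cyl_generator big1 ?scaler0 // => u _; rewrite big1 // => v _.
rewrite (_ : move_pattern _ _ = empty_pattern) ?subrr //.
by apply/ffunP => j; rewrite !ffunE.
Qed.

(** The indicator that ball [j] is at [w], centred under the uniform law. *)
Definition position_vector j w : 'rV[R]_N :=
  cyl R (place empty_pattern j w) - n%:R^-1 *: cyl R empty_pattern.

Lemma position_generator j w :
  position_vector j w *m Q = - (alpha * n%:R) *: position_vector j w.
Proof.
have n0 : n%:R != 0 :> R by rewrite pnatr_eq0 -lt0n (leq_ltn_trans _ (ltn_ord w)).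
rewrite mulmxBl -scalemxAl empty_generator scaler0 subr0 cyl_generator.
pose F w' := cyl R (place empty_pattern j w').
rewrite (eq_bigr (fun u => \sum_v (F (tperm u v w) - F w))); last first.
  move=> u _; apply: eq_bigr => v _; congr (cyl R _ - _).
  by apply/ffunP => i; rewrite !ffunE; case: eqP.
rewrite sum_tperm sumrB sumr_const card_ord cyl_place.
rewrite (_ : erase _ _ = empty_pattern); last first.
  by apply/ffunP => i; rewrite !ffunE; case: eqP.
rewrite /position_vector -/(F w); move: (F w) (cyl R empty_pattern) => A B.
apply/rowP => i; rewrite !(mxE, mulmxnE).
rewrite -[A 0 i *+ n]mulr_natr -[_ *+ 2]mulr_natr.
by field.
Qed.

End TraceBounds.

(** Stated for [n.+1] vertices, so that the vertex [ord0] is available. *)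
Section Lower.
Variables (R : realType) (n l : nat) (alpha : R).
Hypothesis ln : (l <= n)%N.
Let T : finType := lep_state n.+1 l.
Let N := #|T|.
Let Q : 'M[R]_N := kernel_mx (@lep_generator R n.+1 l alpha).
Variables (P : 'M[R]_N) (d : 'rV[R]_N).
Hypothesis Punit : P \in unitmx.
Hypothesis QE : Q = invmx P *m diag_mx d *m P.

Lemma state_avoiding0 : exists x : lep_state n.+1 l, forall i, pos x i != ord0.
Proof.
pose b := [tuple lift ord0 (widen_ord ln i) | i < l].
have ub : uniq b.
  rewrite map_inj_uniq ?enum_uniq // => i i' /lift_inj /(congr1 val) e.
  exact: val_inj.
exists (exist _ b ub) => i.
by rewrite /pos tnth_mktuple eq_sym neq_lift.
Qed.

Lemma state_with_position (j : 'I_l) (v : 'I_n) : exists x : lep_state n.+1 l,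
  pos x j = lift ord0 v /\ forall i, pos x i != ord0.
Proof.
have [x x0] := state_avoiding0.
exists (move (tperm (pos x j) (lift ord0 v)) x); split=> [|i].
  by rewrite pos_move tpermL.
rewrite pos_move; apply: contra (x0 i) => /eqP/(canRL (tpermK _ _)) ->.
by rewrite tpermD // eq_sym ?neq_lift // x0.
Qed.

Let J : finType := ('I_l * 'I_n)%type.
Let row_of (p : J) := position_vector R p.1 (lift ord0 p.2).
Let E : 'M[R]_(#|J|, N) := \matrix_p row_of (enum_val p).

(** The vertex [ord0] is left out because the centred indicators of one ball sum to
    zero.  The remaining ones are independent: in a linear relation, compare a
    state with ball [j] at [lift ord0 v] and vertex [ord0] empty to the one where
    the ball has moved to [ord0]; only the coefficient of [(j, v)] changes. *)
Lemma position_free : row_free E.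
Proof.
rewrite -kermx_eq0; apply/eqP/row_matrixP => i; rewrite row0.
set c := row i _; have cE : c *m E = 0 by rewrite -row_mul mulmx_ker row0.
have cE' (x : T) : \sum_(p : J) c 0 (enum_rank p) *
     ((pos x p.1 == lift ord0 p.2)%:R - n.+1%:R^-1) = 0.
  have /rowP/(_ (enum_rank x)) := cE; rewrite mxE [RHS]mxE => cEx; rewrite -[RHS]cEx {cEx}.
  rewrite (reindex (enum_rank : J -> 'I_#|J|)) /=; last first.
    by apply: onW_bij; apply: enum_rank_bij.
  apply: eq_bigr => p _; rewrite !mxE !enum_rankK; congr (_ * (_%:R - _)).
    congr nat_of_bool; apply/eqP/forallP => [e k|/(_ p.1)].
      by rewrite !ffunE; case: eqP => [->|//]; apply/eqP.
    by rewrite !ffunE eqxx => /eqP.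
  by rewrite (_ : matches _ _ = true) ?mulr1 //; apply/forallP => k; rewrite ffunE.
apply/rowP => a; rewrite [RHS]mxE -[a]enum_valK; case: (enum_val a) => j v.
have [x [xj x0]] := state_with_position j v.
have := etrans (cE' x) (esym (cE' (move (tperm (lift ord0 v) ord0) x))).
move=> /eqP; rewrite -subr_eq0 -sumrB (bigD1 (j, v)) //=.
rewrite big1 => [|[k w] /= kw].
  rewrite pos_move xj tpermL eqxx (negPf (neq_lift _ _)) => /eqP e.
  by apply: etrans e; rewrite /=; ring.
rewrite pos_move -mulrBr; have [kj|kj] := eqVneq k j.
  rewrite kj xj tpermL (negPf (neq_lift _ _)) (inj_eq lift_inj).
  rewrite (_ : (v == w) = false) ?subrr ?mulr0 //.
  by apply: contraNF kw => /eqP ->; rewrite kj.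
rewrite tpermD ?subrr ?mulr0 // 1?eq_sym //.
by rewrite -xj (inj_eq (@pos_inj _ _ x)).
Qed.

(** The constants and the [l n] independent position vectors bound from below the
    multiplicities of the two eigenvalues, which are distinct as [alpha > 0]. *)
Lemma trace_lower (s : R) : 0 < alpha ->
  1 + (l * n)%:R * expR (- (s * (alpha * n.+1%:R))) <= \sum_a expR (s * d 0 a).
Proof.
move=> a0.
have EQ : E *m Q = - (alpha * n.+1%:R) *: E.
  apply/row_matrixP => i; rewrite row_mul rowK [row_of _ *m _]position_generator.
  by apply/rowP => k; rewrite !mxE.
have cE : (l * n <= #|[pred a | d 0%R a == - (alpha * n.+1%:R)]|)%N.
  have := position_free; rewrite /row_free => /eqP rE.
  rewrite -[l in X in (X <= _)%N]card_ord -[n in X in (X <= _)%N]card_ord -card_prod.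
  rewrite -[X in (X <= _)%N]rE.
  have := @rank_eigen_leq _ _ P d Punit _ E (- (alpha * n.+1%:R)).
  by rewrite -QE EQ; apply.
have c0 : (0 < #|[pred a | d 0%R a == 0%R]|)%N.
  have := @rank_eigen_leq _ _ P d Punit 1 (cyl R (empty_pattern n.+1 l)) 0.
  rewrite -QE [_ *m _]empty_generator scale0r => /(_ erefl); apply: leq_trans.
  rewrite lt0n mxrank_eq0; apply/negP => /eqP/rowP z.
  have [x _] := state_avoiding0.
  have := z (enum_rank x); rewrite !mxE (_ : matches _ _ = true) => [/eqP|].
    by rewrite oner_eq0.
  by apply/forallP => k; rewrite ffunE.
have an : - (alpha * n.+1%:R) != 0 by rewrite oppr_eq0 mulf_neq0 ?pnatr_eq0 // gt_eqF.
rewrite (bigID (fun a => d 0 a == 0)) /=; apply: lerD.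
  rewrite (eq_bigr (fun=> 1)) => [|a /eqP ->]; last by rewrite mulr0 expR0.
  by rewrite sumr_const ler1n.
rewrite (bigID (fun a => d 0 a == - (alpha * n.+1%:R))) /= -[leLHS]addr0.
apply: lerD; last by apply: sumr_ge0 => a _; apply: expR_ge0.
rewrite (eq_bigl (fun a => d 0 a == - (alpha * n.+1%:R))) => [|a].
  rewrite (eq_bigr (fun=> expR (- (s * (alpha * n.+1%:R))))) => [|a /eqP ->].
    by rewrite sumr_const -[leRHS]mulr_natl ler_wpM2r ?expR_ge0 // ler_nat.
  by rewrite mulrN.
by have [->|] := eqVneq (d 0 a) (- (alpha * n.+1%:R)); rewrite ?an ?andbF.
Qed.

End Lower.

(** * The chi-square distance as a trace *)

Lemma probability_full_setI (R : realType) (d : measure_display)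
  (Omega : measurableType d) (P : probability Omega R) (A B : set Omega) :
  measurable A -> measurable B -> P A = 1%E -> P (A `&` B) = P B.
Proof.
move=> mA mB PA.
have mAC : measurable (~` A) by apply: measurableC.
have PAC : P (~` A) = 0%E by rewrite probability_setC // PA subee.
have PBA : P (B `\` A) = 0%E.
  by apply: subset_measure0 PAC => //; exact: measurableD.
have PB : P B = (P (B `\` A) + P (B `&` A))%E := measureDI P mB mA.
by rewrite PB PBA add0e setIC.
Qed.

Lemma law_transition (R : realType) (S : finType) (Q : S -> S -> R)
    (d : measure_display) (Omega : measurableType d) (P : probability Omega R)
    (X : R -> Omega -> S) (x0 : S) (t : R) (y : S) :
  markov_process Q P X x0 -> 0 <= t -> law P (X t) y = transition Q t x0 y.
Proof.
move=> [mX start markov] t0.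
have := markov 0%N (fun i => if i is 0%N then 0 else t)
  (fun i => if i is 0%N then x0 else y) (lexx _).
rewrite !bigcap_mkord !big_ord_recr !big_ord0 /= !setTI start mul1e subr0.
move=> H; rewrite /law -(probability_full_setI (mX 0 x0 (lexx _)) (mX t y t0) start).
by rewrite H // => -[|i].
Qed.

Section L2.
Variables (R : realType) (n l : nat) (alpha : R).
Let T : finType := lep_state n l.
Let Q : 'M[R]_#|T| := kernel_mx (@lep_generator R n l alpha).
Variables (P : 'M[R]_#|T|) (d : 'rV[R]_#|T|).
Hypothesis Punit : P \in unitmx.
Hypothesis QE : Q = invmx P *m diag_mx d *m P.

(** Expanding the square leaves [N p_{2t}(x0, x0) - 1], by symmetry of the
    exponential and because its rows sum to one; the diagonal being constant, the
    first term is the trace. *)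
Lemma l2dist_transition (x0 : T) t :
  l2dist (transition (@lep_generator R n l alpha) t x0) (uniform R) =
  Num.sqrt (\sum_a expR (2 * t * d 0 a) - 1).
Proof.
pose p := transition (@lep_generator R n l alpha) t x0.
have N0 : #|T|%:R != 0 :> R by rewrite pnatr_eq0 -lt0n; apply/card_gt0P; exists x0.
pose M := expmx (t *: Q).
have sum_T (F : 'I_#|T| -> R) : \sum_(y : T) F (enum_rank y) = \sum_i F i.
  rewrite [RHS](reindex (enum_rank : T -> _)) //.
  by apply: onW_bij; apply: enum_rank_bij.
have sum1 : \sum_y p y = 1.
  pose o : 'cV[R]_#|T| := (cyl R (empty_pattern n l))^T.
  have oE i : o i 0 = 1.
    by rewrite !mxE (_ : matches _ _ = true) //; apply/forallP => j; rewrite ffunE.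
  have Qo : Q *m o = 0.
    by rewrite -[Q]generator_sym -trmx_mul [_ *m _]empty_generator trmx0.
  have := @expmx_fixed _ _ P d t o Punit; rewrite -QE => /(_ Qo).
  move=> /colP/(_ (enum_rank x0)); rewrite oE mxE => <-.
  rewrite -sum_T; apply: eq_bigr => y _; by rewrite oE mulr1.
have sumsq : \sum_y p y ^+ 2 = #|T|%:R^-1 * \sum_a expR (2 * t * d 0 a).
  have -> : \sum_y p y ^+ 2 = (M *m M) (enum_rank x0) (enum_rank x0).
    rewrite mxE -sum_T; apply: eq_bigr => y _; rewrite expr2; congr (_ * _).
    rewrite /M -[in RHS](@trmx_expmx _ _ Q t); first by rewrite [RHS]mxE.
    exact: generator_sym.
  have -> : M *m M = expmx (2 * t *: Q) by rewrite /M QE expmx_sqr.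
  have <- : \tr (expmx (2 * t *: Q)) = \sum_a expR (2 * t * d 0 a).
    by rewrite QE mxtrace_expmx.
  rewrite /mxtrace -sum_T.
  rewrite (eq_bigr (fun=> expmx (2 * t *: Q) (enum_rank x0) (enum_rank x0))).
    by rewrite sumr_const -[X in _ = _^-1 * X]mulr_natl mulKf.
  by move=> y _; apply: transition_diag.
rewrite /l2dist; congr Num.sqrt.
rewrite (eq_bigr (fun y => #|T|%:R * p y ^+ 2 - 2 * p y + #|T|%:R^-1)); last first.
  by move=> y _; rewrite /uniform -/p /=; field.
rewrite big_split sumrB /= -!mulr_sumr sum1 sumsq sumr_const.
by rewrite mulVKf // -[X in _ + X = _]mulr_natr mulVf //; ring.
Qed.

End L2.

(** * Estimate of the sum over the levels *)

Section SumBound.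
Variable R : realType.

(** The decay rate of level [k] in units of the rate of level one. *)
Definition rate (n k : nat) : R := (k * (n - k).+1)%:R / n%:R.

(** The contribution of level [k] to the bound of [trace_upper] at the time given
    by [c = 0]. *)
Definition weight (n l k : nat) : R :=
  ('C(l, k) * n ^ k)%:R * expR (- (ln (l%:R * (n%:R - 1)) * rate n k)).

Lemma rate_ge1 n k : (0 < k <= n)%N -> 1 <= rate n k.
Proof.
move=> /andP[k0 kn]; have n0 : (0 < n)%N by apply: leq_trans kn.
rewrite ler_pdivlMr ?ltr0n // mul1r ler_nat.
by nia.
Qed.

Lemma rateE n k : (0 < n)%N -> (0 < k <= n)%N ->
  rate n k = k%:R - k%:R * (k%:R - 1) / n%:R.
Proof.
move=> n0 /andP[k0 kn]; rewrite /rate natrM -addn1 natrD natrB //.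
have : n%:R != 0 :> R by rewrite pnatr_eq0 -lt0n.
by move=> h; field.
Qed.

Lemma fact_ge_expn k : (2 ^ k <= k.+1`!)%N.
Proof. by elim: k => // k IH; rewrite factS expnS leq_mul. Qed.

Lemma expn_fact_le_expR k : k%:R ^+ k / k`!%:R <= expR 1 ^+ k :> R.
Proof.
case: k => [|k]; first by rewrite !expr0 divr1.
rewrite -expRM_natl mulr1.
have := @expR_ge1Dxn R k.+1%:R k (ler0n _ _).
by apply: le_trans; rewrite lerDr.
Qed.

(** Uses [C(l,k) <= l^k / k!] and [l (n - 1) <= n^2]. *)
Lemma weight_le n l k : (3 <= n)%N -> (0 < k <= l)%N -> (l <= n)%N ->
  weight n l k <= (n%:R / (n%:R - 1)) ^+ k / k`!%:R *
     expR (k%:R * (2 * (k%:R - 1) * ln n%:R / n%:R)).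
Proof.
move=> n3 /andP[k0 kl] ln_; have n0 : (0 < n)%N by apply: leq_trans n3.
have nR : 3 <= n%:R :> R by rewrite (ler_nat _ 3).
have l1 : 1 <= l%:R :> R by rewrite ler1n (leq_trans k0).
have L0 : 0 < l%:R * (n%:R - 1) :> R by rewrite mulr_gt0; lra.
have lnL : ln (l%:R * (n%:R - 1)) <= 2 * ln n%:R :> R.
  have -> : 2 * ln n%:R = ln (n%:R ^+ 2) :> R by rewrite lnXn ?mulr_natl; lra.
  rewrite ler_ln ?posrE ?exprn_gt0 //; last lra.
  have : l%:R <= n%:R :> R by rewrite ler_nat.
  by nra.
rewrite /weight rateE //; last by rewrite k0 (leq_trans kl).
rewrite mulrBr opprB addrC expRD mulrA.
have k1 : 1 <= k%:R :> R by rewrite ler1n.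
apply: ler_pM; rewrite ?expR_ge0 ?mulr_ge0 ?ler0n ?expR_ge0 //.
  rewrite expRN -[X in expR X]mulrC expRM_natl lnK ?posrE //.
  rewrite natrM natrX ler_pdivrMr ?exprn_gt0 //.
  rewrite expr_div_n exprMn.
  have c1 : 'C(l, k)%:R <= l%:R ^+ k / k`!%:R :> R.
    rewrite ler_pdivlMr ?ltr0n ?fact_gt0 // -natrM -natrX ler_nat bin_ffact.
    rewrite ffact_prod -[X in (_ <= _ ^ X)%N]card_ord -prod_nat_const.
    by apply: leq_prod => i _; apply: leq_subr.
  have nn : n%:R - 1 != 0 :> R by rewrite gt_eqF //; lra.
  rewrite (_ : _ / _ / _ * _ = l%:R ^+ k / k`!%:R * n%:R ^+ k); last first.
    by field; rewrite ?expf_neq0 ?pnatr_eq0 -?lt0n ?fact_gt0.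
  by rewrite ler_wpM2r ?exprn_ge0 ?ler0n.
rewrite ler_expR -subr_ge0 (_ : _ - _ = k%:R * (k%:R - 1) / n%:R *
  (2 * ln n%:R - ln (l%:R * (n%:R - 1)))); last by ring.
by rewrite mulr_ge0 ?subr_ge0 // mulr_ge0 ?invr_ge0 ?ler0n // mulr_ge0 ?subr_ge0 ?ler0n.
Qed.

End SumBound.

Section GeometricBound.
Variable R : realType.

(** Follows from [z^2 / 2 <= exp z] at [z = eps x]. *)
Lemma exp_beats_linear (eps x : R) : 0 < eps -> 0 < x ->
  x * expR (- (eps * x)) <= 2 / (eps ^+ 2 * x).
Proof.
move=> e0 x0; have ex0 : 0 <= eps * x by rewrite mulr_ge0 // ltW.
have h : (eps * x) ^+ 2 / 2 <= expR (eps * x).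
  by apply: le_trans (expR_ge1Dxn 1 ex0); rewrite lerDr.
have p0 : 0 < eps ^+ 2 * x by rewrite mulr_gt0 ?exprn_gt0.
rewrite expRN ler_pdivrMr ?expR_gt0 // mulrAC ler_pdivlMr //.
rewrite (_ : x * _ = 2 * ((eps * x) ^+ 2 / 2)); last by field.
by rewrite ler_wpM2l.
Qed.

(** Two regimes, according to [y = 2 (k - 1) ln n / n].  If [y <= 1 / 10], the
    base of the power is at most [6 / 5], and [k! >= 2^(k - 1)] gives the first
    geometric term.  Otherwise [1 / k <= 20 ln n / n], while
    [exp y <= n exp (- eps ln n)]; with [k! >= (k / e)^k], the base is at most
    [21 e ln n exp (- eps ln n) <= 42 e / (eps^2 ln n)], hence at most [1 / 2] by
    the lower bound on [ln n]. *)
Lemma weight_le_geometric (eps : R) n l k : 0 < eps < 1 ->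
  (21 <= n)%N -> l%:R <= (1 - eps) * n%:R / 2 ->
  84 * expR 1 / eps ^+ 2 <= ln n%:R ->
  (0 < k <= l)%N ->
  weight R n l k <= 6 / 5 * (3 / 5) ^+ k.-1 + 2^-1 ^+ k.
Proof.
move=> /andP[e0 e1] n21 ln_ nbig kl; have /andP[k0 klel] := kl.
have nR : 21 <= n%:R :> R by rewrite (ler_nat _ 21).
have lnN : (l <= n)%N by rewrite -(ler_nat R); apply: (le_trans ln_); nra.
have n3 : (3 <= n)%N by apply: leq_trans n21.
apply: (le_trans (weight_le R n3 kl lnN)).
have k1 : 1 <= k%:R :> R by rewrite ler1n.
have kR : k%:R <= l%:R :> R by rewrite ler_nat.
set rho := n%:R / (n%:R - 1).
have rho0 : 0 <= rho by rewrite divr_ge0; lra.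
have rho1 : rho <= 21 / 20 by rewrite ler_pdivrMr; lra.
have E0 := expR_gt0 (1 : R).
have x0 : 0 < ln n%:R :> R.
  by apply: lt_le_trans nbig; rewrite divr_gt0 ?mulr_gt0 ?exprn_gt0.
have f0 : 0 < k`!%:R :> R by rewrite ltr0n fact_gt0.
rewrite expRM_natl.
set y := 2 * (k%:R - 1) * ln n%:R / n%:R.
have y0 : 0 <= y.
  by rewrite /y !mulr_ge0 ?invr_ge0 ?ler0n ?subr_ge0 // ltW.
rewrite mulrAC -exprMn.
have b0 : 0 <= rho * expR y by rewrite mulr_ge0 ?expR_ge0.
have [ysmall|ybig] := leP y (1 / 10).
  rewrite -[leLHS]addr0 lerD ?exprn_ge0 ?invr_ge0 //.
  have ey : rho * expR y <= 6 / 5.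
    have e9 : expR y <= 10 / 9.
      have h : 1 + - (1 / 10) <= expR (- y) by apply: le_trans (expR_ge1Dx _); lra.
      move: h; rewrite expRN => h; have ep := expR_gt0 y.
      rewrite -[expR y]invrK -[10 / 9]invrK lef_pV2 ?posrE ?invr_gt0 //; lra.
    by have := expR_gt0 y; nra.
  rewrite ler_pdivrMr //.
  apply: (@le_trans _ _ ((6 / 5) ^+ k)); first by rewrite lerXn2r ?nnegrE //; lra.
  case: k k0 {kl klel k1 kR y ysmall y0 f0 ey b0} => // k _ /=.
  apply: (@le_trans _ _ (6 / 5 * (3 / 5) ^+ k * 2 ^+ k)).
    by rewrite -mulrA -exprMn exprS (_ : 3 / 5 * 2 = 6 / 5 :> R) //; field.
  rewrite ler_wpM2l ?mulr_ge0 ?exprn_ge0 ?divr_ge0 //.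
  by rewrite -natrX ler_nat fact_ge_expn.
rewrite -[leLHS]add0r lerD ?mulr_ge0 ?exprn_ge0 ?divr_ge0 //.
have kpos : 0 < k%:R :> R by lra.
apply: (@le_trans _ _ ((rho * expR y * (expR 1 / k%:R)) ^+ k)).
  rewrite [leRHS]exprMn ler_wpM2l ?exprn_ge0 //.
  rewrite expr_div_n ler_pdivlMr ?exprn_gt0 // mulrC.
  exact: expn_fact_le_expR.
apply: lerXn2r; rewrite ?nnegrE ?invr_ge0 ?ler0n //.
  by rewrite (mulr_ge0 b0) ?divr_ge0 ?expR_ge0 ?ler0n.
have npos : 0 < n%:R :> R by lra.
have kinv : k%:R^-1 <= 20 * ln n%:R / n%:R :> R.
  rewrite ler_pdivlMr // mulrC ler_pdivrMr //.
  move: ybig; rewrite /y ltr_pdivlMr // => h.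
  by have := ltW x0; nra.
have ey : expR y <= n%:R * expR (- (eps * ln n%:R)).
  rewrite -[X in X * _]lnK ?posrE // -expRD ler_expR.
  rewrite /y ler_pdivrMr //.
  have h : 2 * (k%:R - 1) <= (1 - eps) * n%:R by lra.
  have := ler_wpM2r (ltW x0) h.
  by move=> /le_trans; apply; rewrite le_eqVlt; apply/orP; left; apply/eqP; ring.
have hx := exp_beats_linear e0 x0.
set x := ln n%:R in x0 nbig kinv ey hx *.
set w := expR (- (eps * x)) in ey hx *.
have w0 : 0 <= w by apply: expR_ge0.
apply: (@le_trans _ _ (21 / 20 * (n%:R * w) * (expR 1 * (20 * x / n%:R)))).
  apply: (ler_pM b0).
  - by rewrite divr_ge0 ?expR_ge0 ?ler0n.
  - by apply: (ler_pM rho0 (expR_ge0 y) rho1 ey).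
  - by rewrite ler_wpM2l // ltW.
rewrite [leLHS](_ : _ = 21 * expR 1 * (x * w)); last by field; lra.
apply: (@le_trans _ _ (21 * expR 1 * (2 / (eps ^+ 2 * x)))).
  by rewrite ler_wpM2l // mulr_ge0 // ltW.
have e2 : 0 < eps ^+ 2 by rewrite exprn_gt0.
move: nbig; rewrite ler_pdivrMr // => nbig.
rewrite mulrA ler_pdivrMr ?mulr_gt0 //.
by lra.
Qed.

Lemma sum_weight_le4 (eps : R) : 0 < eps < 1 ->
  exists n0 : nat, forall n l, (n0 <= n)%N -> l%:R <= (1 - eps) * n%:R / 2 ->
    \sum_(i < l) weight R n l i.+1 <= 4.
Proof.
move=> he; set M := expR (84 * expR 1 / eps ^+ 2).
exists (maxn 21 (Num.bound M)) => n l; rewrite geq_max => /andP[n21 nM] hl.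
have big : 84 * expR 1 / eps ^+ 2 <= ln n%:R.
  rewrite -[leLHS]expRK ler_ln ?posrE ?expR_gt0 ?ltr0n ?(leq_trans _ n21) //.
  apply: le_trans (ltW (archi_boundP _)) _; first exact: expR_ge0.
  by rewrite ler_nat.
have S m : \sum_(i < m) (6 / 5 * (3 / 5) ^+ i + 2^-1 ^+ i.+1) =
    4 - 3 * (3 / 5) ^+ m - 2^-1 ^+ m :> R.
  elim: m => [|m IH]; first by rewrite big_ord0 !expr0; ring.
  by rewrite big_ord_recr /= IH !exprS; field.
apply: (@le_trans _ _ (\sum_(i < l) (6 / 5 * (3 / 5) ^+ i + 2^-1 ^+ i.+1))).
  apply: ler_sum => i _.
  exact: (@weight_le_geometric eps n l i.+1 he n21 hl big (ltn_ord i)).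
rewrite S -addrA gerDl -opprD oppr_le0 addr_ge0 ?mulr_ge0 ?exprn_ge0 ?divr_ge0 //.
Qed.

(** The exponentials are at most one, and the binomial theorem sums the rest. *)
Lemma sum_weight_le_expn n l : (0 < l)%N -> (3 <= n)%N -> (l <= n)%N ->
  \sum_(i < l) weight R n l i.+1 <= (n.+1 ^ n)%:R.
Proof.
move=> l0 n3 ln_.
apply: (@le_trans _ _ (n.+1 ^ l)%:R); last by rewrite ler_nat leq_pexp2l.
rewrite -add1n expnDn big_ord_recl /= addnC natrD -[leLHS]addr0 lerD ?ler0n //.
rewrite natr_sum; apply: ler_sum => i _; rewrite /weight exp1n mul1n.
rewrite -[leRHS]mulr1 ler_wpM2l ?ler0n // expR_le1 oppr_le0 mulr_ge0 //.
  have nR : 3 <= n%:R :> R by rewrite (ler_nat _ 3).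
  have l1 : 1 <= l%:R :> R by rewrite ler1n.
  by apply: ln_ge0; apply: (le_trans l1); rewrite ler_peMr; lra.
by rewrite divr_ge0 ?ler0n.
Qed.

End GeometricBound.

(** * Mixing *)

Section Mixing.
Variable R : realType.

Lemma time_rate (n l : nat) (c : R) :
  2 * (n.+1%:R / 4 * ln (l%:R * (n.+1%:R - 1)) + c * n.+1%:R) * (2 / n.+1%:R ^+ 2) =
  (ln (l%:R * (n.+1%:R - 1)) + 4 * c) / n.+1%:R.
Proof. by have h : n.+1%:R != 0 :> R by []; field. Qed.

(** By [time_rate], the exponent at level [k] is [ln (l (n - 1)) + 4 c] times
    [rate n k].  The latter is [1] for the lower bound, and at least [1] in the
    upper bound, so that [exp (- 4 c)] factors out. *)
Lemma lep_spectrum (n l : nat) : (1 <= l)%N -> (l <= n)%N -> (2 <= n)%N ->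
  exists m, exists d : 'rV[R]_m,
  [/\ forall (dO : measure_display) (Omega : measurableType dO)
        (P : probability Omega R) (X : R -> Omega -> lep_state n.+1 l)
        (x0 : lep_state n.+1 l) (t : R),
        markov_process (lep_generator (2 / n.+1%:R ^+ 2)) P X x0 -> 0 <= t ->
        l2dist (law P (X t)) (uniform R) = Num.sqrt (\sum_a expR (2 * t * d 0 a) - 1),
      forall c t, t = n.+1%:R / 4 * ln (l%:R * (n.+1%:R - 1)) + c * n.+1%:R ->
        expR (- (4 * c)) <= \sum_a expR (2 * t * d 0 a) - 1 &
      forall c t, t = n.+1%:R / 4 * ln (l%:R * (n.+1%:R - 1)) + c * n.+1%:R ->
        0 <= t -> 0 <= c ->
        \sum_a expR (2 * t * d 0 a) - 1 <=
          expR (- (4 * c)) * \sum_(i < l) weight R n.+1 l i.+1].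
Proof.
move=> l1 ln_ n2.
set alpha : R := 2 / n.+1%:R ^+ 2.
have a0 : 0 < alpha by rewrite divr_gt0 ?exprn_gt0.
have [P [d [Punit QE]]] := symmetric_diagonalizable (generator_sym n.+1 l alpha).
have lR : 1 <= l%:R :> R by rewrite ler1n.
have nR : 2 <= n%:R :> R by rewrite (ler_nat _ 2).
have L0 : 0 < l%:R * (n.+1%:R - 1) :> R by rewrite -natr1 mulr_gt0; lra.
exists _, d; split=> [dO Omega Pr X x0 t mX t0|c t tE|c t tE t0 c0].
- rewrite (_ : law _ _ = transition (lep_generator alpha) t x0).
    exact: l2dist_transition Punit QE x0 t.
  by apply/funext => y; apply: law_transition mX t0.
- have := trace_lower ln_ Punit QE (2 * t) a0.
  rewrite -lerBrDl => /(le_trans _); apply.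
  have -> : (l * n)%:R = expR (ln (l%:R * (n.+1%:R - 1))) :> R.
    by rewrite lnK ?posrE // natrM -natr1 addrK.
  rewrite -expRD ler_expR mulrA tE time_rate mulfVK //.
  by rewrite le_eqVlt; apply/orP; left; apply/eqP; ring.
- have := trace_upper Punit QE (ltW a0) (mulr_ge0 (ler0n _ 2) t0).
  rewrite big_ord_recl /= mul0n mulr0 mulr0 oppr0 expR0 bin0 expn0 mulr1.
  rewrite -lerBlDl => /le_trans; apply.
  rewrite mulr_sumr; apply: ler_sum => i _.
  rewrite /bump /= add1n /weight [leRHS]mulrCA ler_wpM2l ?ler0n //.
  rewrite -expRD ler_expR mulrA tE time_rate.
  rewrite -mulrA [_^-1 * _]mulrC -/(rate R n.+1 i.+1) mulrDl opprD [leRHS]addrC lerD2l.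
  rewrite lerN2 ler_peMr ?mulr_ge0 //.
  by apply: rate_ge1; rewrite /= (leq_trans (ltn_ord i)) // ltnW.
Qed.

Lemma size_bounds (eps : R) (n l : nat) : 0 < eps < 1 -> (1 <= l)%N ->
  l%:R <= (1 - eps) * n%:R / 2 -> exists2 m, n = m.+1 & (l <= m)%N && (2 <= m)%N.
Proof.
move=> /andP[e0 e1] l1 h; have lR : 1 <= l%:R :> R by rewrite ler1n.
have n0 : 0 <= n%:R :> R by rewrite ler0n.
have n2l : (2 * l < n)%N by rewrite -(ltr_nat R) natrM; nra.
by case: n n2l {h n0} => // m h; exists m => //; lia.
Qed.

Variable eps : R.
Hypothesis heps : 0 < eps < 1.

Lemma expR_sqr (c : R) : expR (- (4 * c)) = expR (- (2 * c)) ^+ 2.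
Proof. by rewrite -expRM_natl; congr expR; ring. Qed.

Lemma l2dist_lep_ge (n l : nat) (d : measure_display) (Omega : measurableType d)
    (P : probability Omega R) (X : R -> Omega -> lep_state n l)
    (x0 : lep_state n l) (c t : R) :
  (1 <= l)%N -> l%:R <= (1 - eps) * n%:R / 2 ->
  markov_process (lep_generator (2 / n%:R ^+ 2)) P X x0 ->
  t = n%:R / 4 * ln (l%:R * (n%:R - 1)) + c * n%:R -> 0 <= t ->
  expR (- (2 * c)) <= l2dist (law P (X t)) (uniform R).
Proof.
move=> l1 hl mX tE t0.
have [m nm /andP[lm m2]] := size_bounds heps l1 hl; subst n.
have [N [v [dist low _]]] := lep_spectrum l1 lm m2.
rewrite (dist _ _ _ _ _ _ mX t0) -[leLHS]ger0_norm ?expR_ge0 // -sqrtr_sqr.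
by rewrite ler_wsqrtr // -expR_sqr low.
Qed.

Lemma l2dist_lep_le (n l : nat) (d : measure_display) (Omega : measurableType d)
    (P : probability Omega R) (X : R -> Omega -> lep_state n l)
    (x0 : lep_state n l) (c t K : R) :
  (1 <= l)%N -> l%:R <= (1 - eps) * n%:R / 2 ->
  markov_process (lep_generator (2 / n%:R ^+ 2)) P X x0 ->
  t = n%:R / 4 * ln (l%:R * (n%:R - 1)) + c * n%:R -> 0 <= t -> 0 <= c ->
  \sum_(i < l) weight R n l i.+1 <= K ->
  l2dist (law P (X t)) (uniform R) <= Num.sqrt (expR (- (4 * c)) * K).
Proof.
move=> l1 hl mX tE t0 c0 hK.
have [m nm /andP[lm m2]] := size_bounds heps l1 hl; subst n.
have [N [v [dist _ up]]] := lep_spectrum l1 lm m2.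
rewrite (dist _ _ _ _ _ _ mX t0) ler_wsqrtr //.
by apply: (le_trans (up c t tE t0 c0)); rewrite ler_wpM2l ?expR_ge0.
Qed.

(** The constant for large [n] plus a bound for the finitely many small ones. *)
Lemma sum_weight_bounded : exists2 K : R, 4 <= K & forall n l : nat,
  (1 <= l)%N -> l%:R <= (1 - eps) * n%:R / 2 ->
  \sum_(i < l) weight R n l i.+1 <= K.
Proof.
have [n0 sum4] := sum_weight_le4 heps.
exists (4 + (n0.+1 ^ n0)%:R) => [|n l l1 hl]; first by rewrite lerDl ler0n.
have [m nm /andP[lm m2]] := size_bounds heps l1 hl.
have [nn0|nn0] := leqP n0 n.
  by apply: (le_trans (sum4 n l nn0 hl)); rewrite lerDl ler0n.
have n3 : (3 <= n)%N by rewrite nm.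
have ln_ : (l <= n)%N by rewrite nm leqW.
apply: (le_trans (sum_weight_le_expn R l1 n3 ln_)).
rewrite -[leLHS]add0r lerD // ler_nat.
apply: (@leq_trans (n0.+1 ^ n)); last by rewrite leq_pexp2l // ltnW.
by rewrite leq_exp2r ?ltnS ?(ltnW nn0) //; apply: leq_trans n3.
Qed.

Section MixingTime.
Variables (n l : nat) (d : measure_display) (Omega : measurableType d).
Variables (P : lep_state n l -> probability Omega R).
Variables (X : R -> Omega -> lep_state n l) (delta : R).
Hypothesis l1 : (1 <= l)%N.
Hypothesis hl : l%:R <= (1 - eps) * n%:R / 2.
Hypothesis mX :
  forall x0, markov_process (lep_generator (2 / n%:R ^+ 2)) (P x0) X x0.
Hypothesis hdelta : 0 < delta < 1.

Let lR : 1 <= l%:R :> R. Proof. by rewrite ler1n. Qed.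

Let nR : 3 <= n%:R :> R.
Proof.
by have [m -> /andP[_ m2]] := size_bounds heps l1 hl; rewrite (ler_nat _ 3).
Qed.

Let L1 : 1 <= l%:R * (n%:R - 1) :> R.
Proof. by have [n3 l0] := (nR, lR); apply: (le_trans lR); rewrite ler_peMr; lra. Qed.

(** The constant solves [K exp (- 4 c) = (2 delta)^2] for [c]. *)
Lemma mixing_time2_le (K : R) : 4 <= K ->
  \sum_(i < l) weight R n l i.+1 <= K ->
  (mixing_time2 (uniform R) P X delta <=
    (n%:R / 4 * ln (l%:R * n%:R) + ln (K / (4 * delta ^+ 2)) / 4 * n%:R)%:E)%E.
Proof.
move=> K4 sumK; have /andP[d0 d1] := hdelta; have := nR => n3; have := lR => l1R.
have d2 : 0 < delta ^+ 2 by rewrite exprn_gt0.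
have Kd : 1 <= K / (4 * delta ^+ 2).
  rewrite ler_pdivlMr ?mulr_gt0 // mul1r; apply: le_trans K4.
  by have : delta ^+ 2 <= 1; [rewrite expr_le1 // ltW | lra].
set c := ln (K / (4 * delta ^+ 2)) / 4.
have c0 : 0 <= c by rewrite divr_ge0 // ln_ge0.
have n0 : 0 <= n%:R :> R by rewrite ler0n.
pose t := n%:R / 4 * ln (l%:R * (n%:R - 1)) + c * n%:R.
have t0 : 0 <= t.
  apply: addr_ge0; last exact: mulr_ge0.
  by apply: mulr_ge0; [exact: divr_ge0|exact: ln_ge0].
apply: (@le_trans _ _ t%:E).
  apply: ereal_inf_lbound; exists t => //; split=> //.
  apply: bigmax_le => [|x0 _]; first by rewrite mulr_ge0 // ltW.
  apply: (le_trans (l2dist_lep_le l1 hl (mX x0) erefl t0 c0 sumK)).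
  rewrite (_ : expR _ * K = (2 * delta) ^+ 2).
    by rewrite sqrtr_sqr ger0_norm // mulr_ge0 // ltW.
  rewrite expRN (_ : 4 * c = ln (K / (4 * delta ^+ 2))); last by rewrite /c mulrC divfK.
  rewrite lnK ?posrE; last exact: lt_le_trans Kd.
  by rewrite invf_div divfK; [ring|rewrite gt_eqF //; exact: lt_le_trans K4].
rewrite lee_fin lerD2r ler_wpM2l ?divr_ge0 //.
rewrite ler_ln ?posrE; last by rewrite mulr_gt0; lra.
  by rewrite ler_wpM2l; lra.
exact: lt_le_trans L1.
Qed.

(** Since [2 delta < 2], the lower bound on the distance forces [c >= - 1].  One
    more [n] covers the replacement of [n - 1] by [n] in the logarithm, because
    [n / (n - 1) <= 2]. *)
Lemma mixing_time2_ge :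
  ((n%:R / 4 * ln (l%:R * n%:R) - 2 * n%:R)%:E <=
    mixing_time2 (uniform R) P X delta)%E.
Proof.
have /andP[d0 d1] := hdelta; have := nR => n3; have := lR => l1R; have := L1 => LR.
have lnL : ln (l%:R * n%:R) - 2 <= ln (l%:R * (n%:R - 1)) :> R.
  have : ln (l%:R * n%:R) <= ln (2 * (l%:R * (n%:R - 1))) :> R.
    by rewrite ler_ln ?posrE; [nra|rewrite mulr_gt0; lra|lra].
  rewrite [in leRHS]lnM ?posrE; [|lra|lra].
  by have := @ln_sublinear R 2 (ltr0n R 2); lra.
apply: le_ereal_inf_tmp => _ [t [t0 ht] <-]; rewrite lee_fin.
pose c := (t - n%:R / 4 * ln (l%:R * (n%:R - 1))) / n%:R.
have tE : t = n%:R / 4 * ln (l%:R * (n%:R - 1)) + c * n%:R.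
  by rewrite /c divfK; [ring|rewrite gt_eqF //; lra].
have [x0 _] : exists x0 : lep_state n l, True.
  have [m -> /andP[lm _]] := size_bounds heps l1 hl.
  by have [x _] := state_avoiding0 lm; exists x.
have h : expR (- (2 * c)) <= 2.
  apply: (le_trans (l2dist_lep_ge l1 hl (mX x0) tE t0)).
  apply: (le_trans (le_bigmax 0
    (fun x => l2dist (law (P x) (X t)) (uniform R)) x0)).
  by apply: (le_trans ht); lra.
have c1 : -1 <= c by have := expR_ge1Dx (- (2 * c)); lra.
by rewrite tE; nra.
Qed.

End MixingTime.
End Mixing.

Theorem theorem1p7 (R : realType) (eps : R) (heps : 0 < eps < 1) :
  (forall (n l : nat) (d : measure_display) (Omega : measurableType d)
      (P : probability Omega R) (X : R -> Omega -> lep_state n l)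
      (x0 : lep_state n l) (c t : R),
    (1 <= l)%N -> l%:R <= (1 - eps) * n%:R / 2 ->
    markov_process (lep_generator (2 / n%:R ^+ 2)) P X x0 ->
    t = n%:R / 4 * ln (l%:R * (n%:R - 1)) + c * n%:R -> 0 <= t ->
    expR (- (2 * c)) <= l2dist (law P (X t)) (uniform R))
  /\
  (exists n0 : nat,
    forall (n l : nat) (d : measure_display) (Omega : measurableType d)
      (P : probability Omega R) (X : R -> Omega -> lep_state n l)
      (x0 : lep_state n l) (c t : R),
    (n0 <= n)%N -> (1 <= l)%N -> l%:R <= (1 - eps) * n%:R / 2 ->
    markov_process (lep_generator (2 / n%:R ^+ 2)) P X x0 ->
    t = n%:R / 4 * ln (l%:R * (n%:R - 1)) + c * n%:R -> 0 <= t -> 0 <= c ->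
    l2dist (law P (X t)) (uniform R) <= 2 * expR (- (2 * c)))
  /\
  (forall delta : R, 0 < delta < 1 ->
    exists C : R,
    forall (n l : nat) (d : measure_display) (Omega : measurableType d)
      (P : lep_state n l -> probability Omega R) (X : R -> Omega -> lep_state n l),
    (1 <= l)%N -> l%:R <= (1 - eps) * n%:R / 2 ->
    (forall x0, markov_process (lep_generator (2 / n%:R ^+ 2)) (P x0) X x0) ->
    (`| mixing_time2 (uniform R) P X delta
        - (n%:R / 4 * ln (l%:R * n%:R))%:E | <= (C * n%:R)%:E)%E).
Proof.
have [n0 sum4] := sum_weight_le4 heps.
split; last split.
- by move=> n l d Omega P X x0 c t; apply: l2dist_lep_ge.
- exists n0 => n l d Omega P X x0 c t nn0 l1 hl mX tE t0 c0.
  apply: (le_trans (l2dist_lep_le heps l1 hl mX tE t0 c0 (sum4 n l nn0 hl))).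
  rewrite expR_sqr (_ : _ * 4 = (2 * expR (- (2 * c))) ^+ 2); last by ring.
  by rewrite sqrtr_sqr ger0_norm // mulr_ge0 ?expR_ge0.
- move=> delta hdelta; have [K K4 sumK] := sum_weight_bounded heps.
  have /andP[d0 d1] := hdelta.
  have c0 : 0 <= ln (K / (4 * delta ^+ 2)).
    rewrite ln_ge0 // ler_pdivlMr ?mulr_gt0 ?exprn_gt0 // mul1r.
    apply: le_trans K4.
    by have : delta ^+ 2 <= 1; [rewrite expr_le1 // ltW | lra].
  exists (ln (K / (4 * delta ^+ 2)) / 4 + 2) => n l d Omega P X l1 hl mX.
  have up := mixing_time2_le heps l1 hl mX hdelta K4 (sumK n l l1 hl).
  have low := mixing_time2_ge heps l1 hl mX hdelta.
  set A := mixing_time2 _ _ _ _ in up low *.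
  have Afin : A \is a fin_num.
    by rewrite fin_numE -ltNye -ltey (lt_le_trans (ltNyr _) low) (le_lt_trans up (ltry _)).
  rewrite -(fineK Afin) in up low *.
  rewrite -EFinB abse_EFin lee_fin ler_norml.
  have n0R : 0 <= n%:R :> R by rewrite ler0n.
  by move: up low; rewrite !lee_fin => up low; apply/andP; split; nra.
Qed.
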